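(* Let $d\ge 1+\sqrt3$, and consider the $P_1$ (continuous piecewise linear) finite-element discretization on the triangular mesh of the hexagon with nodes $1,\dots,13$ described in the context, with stiffness matrix $A=(a_{i,j})$ and mass matrix $M=(m_{i,j})$. Define $$\lambda_*=\frac{a_{2,2}-2a_{2,3}}{m_{2,2}-2m_{2,3}}.$$ Then, for $\lambda\in\mathbb{R}$, the space of inner solutions $\mathcal{S}_{\rm in}(\lambda)\subset\mathbb{R}^7$ is spanned by $(0,1,-1,1,-1,1,-1)$ if $\lambda=\lambda_*$, and is trivial otherwise.
   Context: The mesh (depending on a parameter $d>2/\sqrt3$): node $1$ is at $(0,0)$; nodes $2,\dots,7$ form the inner ring, node $j+2$ being at $(\cos\frac{j\pi}{3},\sin\frac{j\pi}{3})$ for $0\le j\le5$; nodes $8,\dots,13$ form the outer ring, node $8+k$ being at $(d\cos\frac{(2k-1)\pi}{6},d\sin\frac{(2k-1)\pi}{6})$ for $0\le k\le5$ (so node $8$ lies between nodes $7$ and $2$ in angle, node $9$ between nodes $2$ and $3$, and so on cyclically). The domain $\Omega$ is the regular hexagon with corners at nodes $8,\dots,13$, and it is divided into 18 triangles: six with vertices the origin and two consecutive inner-ring nodes; six with vertices two consecutive inner-ring nodes and the outer-ring node lying between them in angle; and six with vertices two consecutive outer-ring nodes and the inner-ring node lying between them in angle. The interior nodes are $1,\dots,7$ and the boundary nodes are $8,\dots,13$. For each node $\boldsymbol{x}_i$, $\phi_i$ is the continuous function on $\overline\Omega$ that is affine on each triangle with $\phi_i(\boldsymbol{x}_j)=\delta_{i,j}$;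 $a_{i,j}=\int_\Omega\nabla\phi_j\cdot\nabla\phi_i\,dA$ and $m_{i,j}=\int_\Omega\phi_j\phi_i\,dA$. With respect to the partition into interior nodes ($I$) and boundary nodes ($B$), write $$A=\begin{pmatrix} A_{II} & A_{IB} \\ A_{BI} & A_{BB} \end{pmatrix},\qquad M=\begin{pmatrix} M_{II} & M_{IB} \\ M_{BI} & M_{BB} \end{pmatrix},$$ and define $\mathcal{S}_{\rm in}(\lambda)=\ker(A_{II}-\lambda M_{II})\cap\ker(A_{BI}-\lambda M_{BI})\subset\mathbb{R}^7$. *)

(* Defs.v *)
From HB Require Import structures.
From mathcomp Require Import all_boot all_order all_algebra.
From mathcomp Require Import all_classical all_reals all_analysis.
Import Order.TTheory GRing.Theory Num.Theory.
Import numFieldNormedType.Exports.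

Set Implicit Arguments.
Unset Strict Implicit.
Unset Printing Implicit Defensive.

Local Open Scope classical_set_scope.
Local Open Scope ring_scope.

(* Nodes are numbered 1..13; values of [node] outside this range are unused. *)
Definition node (R : realType) (d : R) (n : nat) : R * R :=
  if n == 1%N then (0, 0)
  else if (n <= 7)%N then
    let j := (n - 2)%N%:R in
    (cos (j * pi / 3), sin (j * pi / 3))
  else
    let k := (n - 8)%N%:R in
    (d * cos ((2 * k - 1) * pi / 6), d * sin ((2 * k - 1) * pi / 6)).

(* Closed convex hull of the nodes listed (without repetition) in [s]. *)
Definition node_hull (R : realType) (d : R) (s : seq nat) : set (R * R) :=
  [set p | exists w : nat -> R,
     [/\ forall n, 0 <= w n, \sum_(n <- s) w n = 1
       & p = \sum_(n <- s) w n *: node d n]].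

Definition Omega (R : realType) (d : R) : set (R * R) :=
  interior (node_hull d (iota 8 6)).

(* The outer node between [inner_node k] and [inner_node k.+1] in angle is
   [outer_node k.+1]; the inner node between [outer_node k] and
   [outer_node k.+1] is [inner_node k]. *)
Definition inner_node (k : nat) : nat := (2 + k %% 6)%N.
Definition outer_node (k : nat) : nat := (8 + k %% 6)%N.

Definition mesh : seq (seq nat) :=
  [seq [:: 1%N; inner_node k; inner_node k.+1] | k <- iota 0 6]
  ++ [seq [:: inner_node k; inner_node k.+1; outer_node k.+1] | k <- iota 0 6]
  ++ [seq [:: outer_node k; outer_node k.+1; inner_node k] | k <- iota 0 6].

Definition affine_on (R : realType) (T : set (R * R)) (f : R * R -> R) : Prop :=
  exists a b c : R, forall p, T p -> f p = a + b * p.1 + c * p.2.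

(* Row and column indices are 0-based: index [i] stands for node [i.+1], so that
   the splitting 7 + 6 separates the interior nodes from the boundary nodes. *)
Definition idx (n : nat) : 'I_(7 + 6) := @inord 12 n.-1.

(* Values of the basis functions outside the closure of Omega are irrelevant. *)
Definition nodal_basis (R : realType) (d : R)
    (phi : 'I_(7 + 6) -> R * R -> R) : Prop :=
  forall i,
    [/\ {within closure (Omega d), continuous (phi i)},
        forall t, t \in mesh -> affine_on (node_hull d t) (phi i)
      & forall j : 'I_(7 + 6), phi i (node d j.+1) = (i == j)%:R].

(* Basis functions are differentiable in the interior of each triangle, hence
   almost everywhere in Omega; on the edges ['D_v f p] may be a junk value. *)
Definition grad (R : realType) (f : R * R -> R) (p : R * R) : R * R :=
  ('D_((1, 0) : R * R) f p, 'D_((0, 1) : R * R) f p).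

Definition dot (R : realType) (u v : R * R) : R := u.1 * v.1 + u.2 * v.2.

Definition area (R : realType) := (@lebesgue_measure R \x @lebesgue_measure R)%E.

Definition stiffness (R : realType) (d : R) (phi : 'I_(7 + 6) -> R * R -> R) :
    'M[R]_(7 + 6) :=
  \matrix_(i, j)
    \int[@area R]_(p in Omega d) dot (grad (phi j) p) (grad (phi i) p).

Definition mass (R : realType) (d : R) (phi : 'I_(7 + 6) -> R * R -> R) :
    'M[R]_(7 + 6) :=
  \matrix_(i, j) \int[@area R]_(p in Omega d) (phi j p * phi i p).

(* Kernels of the actions on column vectors ([kermx] would be the left kernel). *)
Definition inner_solutions (R : realType) (A M : 'M[R]_(7 + 6)) (lambda : R) :
    {vspace 'cV[R]_7} :=
  (lker (linfun (mulmx (ulsubmx A - lambda *: ulsubmx M)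
           : 'cV[R]_7 -> 'cV[R]_7))
   :&: lker (linfun (mulmx (dlsubmx A - lambda *: dlsubmx M)
           : 'cV[R]_7 -> 'cV[R]_6)))%VS.

Definition lambda_star (R : realType) (A M : 'M[R]_(7 + 6)) : R :=
  (A (idx 2) (idx 2) - 2 * A (idx 2) (idx 3))
  / (M (idx 2) (idx 2) - 2 * M (idx 2) (idx 3)).

Definition alternating_vec (R : realType) : 'cV[R]_7 :=
  \col_(i < 7) [:: 0; 1; -1; 1; -1; 1; -1]`_i.

(* Main.v *)
Require Import Defs.
From HB Require Import structures.
From mathcomp Require Import all_boot all_order all_algebra.
From mathcomp Require Import all_classical all_reals all_analysis.
From mathcomp Require Import measurable_realfun ring lra.
Import Order.TTheory GRing.Theory Num.Theory.
Import numFieldNormedType.Exports.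
Import HBNNSimple.

Set Implicit Arguments.
Unset Strict Implicit.
Unset Printing Implicit Defensive.

Local Open Scope classical_set_scope.
Local Open Scope ring_scope.

(* On each triangle the basis functions are the barycentric coordinates, so the
   entries of A and M are sums over the 18 triangles of integrals that an affine
   change of variables reduces to those of one fixed triangle.  Write L = A - lambda M.
   - The six boundary rows of L say z (u_k + u_{k+1}) = 0 for cyclically consecutive
     inner-ring nodes, with z = a_{8,2} - lambda m_{8,2}, a_{8,2} < 0 < m_{8,2}.
   - If lambda < 0, the interior block of L is positive definite and u = 0.
   - If lambda >= 0, then z < 0 and u alternates on the inner ring; the rows of two
     adjacent inner-ring nodes then give (a_{1,2} - lambda m_{1,2}) u_1 = 0, whence
     u_1 = 0 because a_{1,2} < 0 < m_{1,2}, and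
     (a_{2,2} - 2 a_{2,3} - lambda (m_{2,2} - 2 m_{2,3})) u_2 = 0. *)

(** * Null sets and affine changes of variables *)

(** The split at [lambda = 0] is forced by the boundary coefficient z: it vanishes at the negative
    number a_{8,2} / m_{8,2}, where the boundary rows carry no information. For negative [lambda] an
    energy argument replaces them, since a positive multiple of the positive definite M is added to
    the positive semidefinite A. The reference integrals are never evaluated: the local stiffness
    matrices are Gram matrices of edge vectors times [std_area] over the determinant, the local mass
    matrices are multiples of one matrix with two different values, and signs of a few combinations
    decide everything. The analytic obstacle is that [phi] is known only through its defining
    properties, so its gradient is controlled only inside the open triangles. Hence [Omega] has to
    be exhibited as a disjoint union of open triangles up to finitely many lines. *)

Section null_sets.
Local Open Scope ereal_scope.
Context d (T : measurableType d) (R : realType) (mu : {measure set T -> \bar R}).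

(** The integral is a supremum over simple functions below [f]. Cutting such a function off on the
    null set [N] keeps its integral and puts it below [g], so neither [f] nor [g] has to be
    measurable. *)
Lemma le_integral_off_null (N : set T) (f g : T -> \bar R) :
  measurable N -> mu N = 0 -> (forall x, 0 <= f x) -> (forall x, 0 <= g x) ->
  (forall x, ~ N x -> f x <= g x) -> \int[mu]_x f x <= \int[mu]_x g x.
Proof.
move=> mN N0 f0 g0 fg; rewrite !ge0_integralTE//.
apply: ge_ereal_sup => _ [h hf <-].
have mC : measurable (~` N) by exact: measurableC.
apply: le_ereal_sup_tmp; exists (sintegral mu (h \_ (~` N))).
  exists (proj_nnsfun h mC); last by rewrite (mrestrict h mC).
  move=> x; rewrite -(mrestrict h mC).
  rewrite /patch; case: ifPn => // /[!inE] Nx.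
  by rewrite (le_trans (hf x))// fg.
have <- : \int[mu]_x (h x)%:E = sintegral mu h by rewrite integral_nnsfun// patch_setT.
rewrite -integral_nnsfun// -setTD -ge0_negligible_integral//.
- exact/measurable_EFinP.
- by move=> x _; rewrite lee_fin.
Qed.

(* [f] need not be measurable: gradients take junk values on the edges of the mesh. *)
Lemma integral_sub_null (D E N : set T) (f : T -> \bar R) :
  measurable N -> mu N = 0 -> E `<=` D -> D `\` E `<=` N ->
  \int[mu]_(x in D) f x = \int[mu]_(x in E) f x.
Proof.
move=> mN N0 ED DEN.
(* The two restrictions of a nonnegative function agree off [N]; [integralE] then treats positive
   and negative parts separately. *)
have ge0_case (g : T -> \bar R) : (forall x, 0 <= g x) ->
    \int[mu]_(x in D) g x = \int[mu]_(x in E) g x.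
  move=> g0; rewrite integral_mkcond [RHS]integral_mkcond.
  apply/eqP; rewrite eq_le; apply/andP; split;
    apply: (@le_integral_off_null N) => // x; rewrite ?erestrict_ge0//.
    move=> Nx; rewrite /patch; case: ifPn => xD; case: ifPn => xE //.
    by exfalso; apply: Nx; apply: DEN; split; [exact/set_mem|by move: xE; rewrite notin_setE].
  move=> Nx; rewrite /patch; case: ifPn => xE; case: ifPn => xD //.
  by move: xD; rewrite (mem_set (ED _ (set_mem xE))).
by rewrite integralE [RHS]integralE !ge0_case.
Qed.

End null_sets.

Section affine_substitution.
Local Open Scope ereal_scope.
Context {R : realType}.
Notation leb := (@lebesgue_measure R).

(** The right-hand side is a measure in [A]; by uniqueness it suffices to compare the two on
    half-open intervals. *)
Lemma lebesgue_measure_affine (al be : R) (A : set R) : al != 0%R ->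
  measurable A ->
  leb A = (`|al|)%:E * leb ((fun x => al * x + be)%R @^-1` A).
Proof.
move=> al0 mA.
have mphi : measurable_fun setT (fun x : measurableTypeR R => (al * x + be)%R : measurableTypeR R).
  by apply: measurable_funD => //; exact: measurable_funM.
pose phi : {mfun measurableTypeR R >-> measurableTypeR R} :=
  HB.pack (fun x : measurableTypeR R => (al * x + be)%R : measurableTypeR R)
    (isMeasurableFun.Build _ _ _ _ _ mphi).
rewrite (@lebesgue_measure_unique R
  (mscale (NngNum (normr_ge0 al)) (pushforward leb phi)))//.
move=> _ [[a b] _ <-]; rewrite /= /mscale/= /pushforward.
have [al_gt0|al_lt0|/eqP] := ltgtP al 0%R; last by rewrite (negbTE al0).
(* Despite the name [al_gt0] this is the case [al < 0]: the map reverses the order, so the preimage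
   of []a, b]] is closed on the left and open on the right. *)
- rewrite (_ : _ @^-1` _ = [set` `[((b - be) / al)%R, ((a - be) / al)%R[ ]); last first.
    apply/seteqP; split=> x /=; rewrite !in_itv/= => /andP[];
      rewrite ler_ndivrMr// ltr_ndivlMr//; lra.
  rewrite !lebesgue_measure_itv/= !lte_fin ltr_nM2r ?invr_lt0// ltrD2r.
  case: ifPn => _; last by rewrite mule0.
  by rewrite -!EFinB -EFinM ltr0_norm//; congr EFin; field.
- rewrite (_ : _ @^-1` _ = [set` `]((a - be) / al)%R, ((b - be) / al)%R] ]); last first.
    apply/seteqP; split=> x /=; rewrite !in_itv/= => /andP[];
      rewrite ltr_pdivrMr// ler_pdivlMr//; lra.
  rewrite !lebesgue_measure_itv/= !lte_fin ltr_pM2r ?invr_gt0// ltrD2r.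
  case: ifPn => _; last by rewrite mule0.
  by rewrite -!EFinB -EFinM gtr0_norm//; congr EFin; field.
Qed.

Lemma ge0_integral_affine (al be : R) (f : R -> \bar R) : al != 0%R ->
  measurable_fun setT f -> (forall x, 0 <= f x) ->
  \int[leb]_x f x = (`|al|)%:E * \int[leb]_x f (al * x + be)%R.
Proof.
move=> al0 mf f0.
have mphi : measurable_fun setT (fun x : measurableTypeR R => (al * x + be)%R : measurableTypeR R).
  by apply: measurable_funD => //; exact: measurable_funM.
pose phi : {mfun measurableTypeR R >-> measurableTypeR R} :=
  HB.pack (fun x : measurableTypeR R => (al * x + be)%R : measurableTypeR R)
    (isMeasurableFun.Build _ _ _ _ _ mphi).
rewrite (eq_measure_integral
  (mscale (NngNum (normr_ge0 al)) (pushforward leb phi))); last first.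
  by move=> A mA _; exact: lebesgue_measure_affine.
by rewrite ge0_integral_mscale// ge0_integral_pushforward.
Qed.

End affine_substitution.

Section shear.
Local Open Scope ereal_scope.
Context {R : realType}.
Notation leb := (@lebesgue_measure R).
Notation mR := (measurableTypeR R).

Lemma measurable_shear_fst (al : R) (g : mR -> mR) : measurable_fun setT g ->
  measurable_fun setT (fun p : mR * mR => (al * p.1 + g p.2, p.2)%R).
Proof.
move=> mg; apply: measurable_fun_pair => //=.
apply: measurable_funD; first by apply: measurable_funM.
exact: measurableT_comp.
Qed.

Lemma measurable_shear_snd (al : R) (g : mR -> mR) : measurable_fun setT g ->
  measurable_fun setT (fun p : mR * mR => (p.1, al * p.2 + g p.1)%R).
Proof.
move=> mg; apply: measurable_fun_pair => //=.
apply: measurable_funD; first by apply: measurable_funM.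
exact: measurableT_comp.
Qed.

(** By Tonelli, for each fixed second coordinate this is an affine substitution on the line, in
    which [g p.2] is a mere translation. *)
Lemma ge0_integral_shear_fst (al : R) (g : mR -> mR) (f : mR * mR -> \bar R) :
  al != 0%R -> measurable_fun setT g -> measurable_fun setT f ->
  (forall p, 0 <= f p) ->
  \int[@area R]_p f p =
  (`|al|)%:E * \int[@area R]_p f (al * p.1 + g p.2, p.2)%R.
Proof.
move=> al0 mg mf f0; rewrite /area.
have mfs : measurable_fun setT (fun p : mR * mR => f (al * p.1 + g p.2, p.2)%R).
  exact: (measurableT_comp mf (measurable_shear_fst al mg)).
rewrite !fubini_tonelli2// /fubini_G -ge0_integralZl//; last 2 first.
- exact: (@measurable_fun_fubini_tonelli_G _ _ mR mR R leb _ mfs (fun=> f0 _)).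
- by move=> y _; apply: integral_ge0.
apply: eq_integral => y _.
rewrite (@ge0_integral_affine R al (g y))//.
exact: (measurableT_comp mf (pair2_measurable y)).
Qed.

Lemma ge0_integral_shear_snd (al : R) (g : mR -> mR) (f : mR * mR -> \bar R) :
  al != 0%R -> measurable_fun setT g -> measurable_fun setT f ->
  (forall p, 0 <= f p) ->
  \int[@area R]_p f p =
  (`|al|)%:E * \int[@area R]_p f (p.1, al * p.2 + g p.1)%R.
Proof.
move=> al0 mg mf f0; rewrite /area.
have mfs : measurable_fun setT (fun p : mR * mR => f (p.1, al * p.2 + g p.1)%R).
  exact: (measurableT_comp mf (measurable_shear_snd al mg)).
rewrite !fubini_tonelli1// /fubini_F -ge0_integralZl//; last 2 first.
- exact: (@measurable_fun_fubini_tonelli_F _ _ mR mR R leb _ mfs (fun=> f0 _)).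
- by move=> y _; apply: integral_ge0.
apply: eq_integral => x _.
rewrite (@ge0_integral_affine R al (g x))//.
exact: (measurableT_comp mf (pair1_measurable x)).
Qed.

End shear.

Section lines.
Context {R : realType}.
Notation mR := (measurableTypeR R).

Definition line (a b c : R) : set (mR * mR) := [set p | a + b * p.1 + c * p.2 = 0].

Lemma measurable_affine (a b c : R) :
  measurable_fun setT (fun p : mR * mR => a + b * p.1 + c * p.2).
Proof.
by apply: measurable_funD; [apply: measurable_funD|]; rewrite //=; apply: measurable_funM.
Qed.

Lemma measurable_line (a b c : R) : measurable (line a b c).
Proof.
rewrite (_ : line a b c = setT `&` (fun p => a + b * p.1 + c * p.2) @^-1` [set 0]).
  exact: measurable_affine.
by rewrite setTI.
Qed.

(** A vertical line is a point times the line; any other line meets each vertical section in one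
    point. *)
Lemma area_line (a b c : R) : (b != 0) || (c != 0) -> area (line a b c) = 0%E.
Proof.
have [->|c0 _] := eqVneq c 0.
  rewrite orbF => b0.
  rewrite (_ : line a b 0 = [set - a / b] `*` setT).
    by rewrite /area product_measure1E//= lebesgue_measure_set1 mul0e.
  apply/seteqP; split=> -[x y]/=; rewrite /line/= mul0r addr0.
    move=> h; split=> //.
    by apply: (mulIf b0); rewrite divfK//; lra.
  by move=> [-> _]; field.
rewrite /area /product_measure1/= /product_measure1.
rewrite integral0_eq// => x _ /=.
rewrite (_ : xsection _ x = [set - (a + b * x) / c]) ?lebesgue_measure_set1//.
apply/seteqP; split=> y; rewrite /xsection/= inE /line/=.
  move=> h; apply: (mulIf c0); rewrite divfK//; lra.
by move=> ->; field.
Qed.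
End lines.

(** * Integration over a triangle *)

Section triangles.
Context {R : realType}.
Notation mR := (measurableTypeR R).
Implicit Types P Q S p : mR * mR.

(** Twice the signed area of the triangle, positive when the vertices run counterclockwise, and
    affine in each vertex. *)
Definition cross P Q S : R :=
  (Q.1 - P.1) * (S.2 - P.2) - (Q.2 - P.2) * (S.1 - P.1).

Definition open_triangle P Q S : set (mR * mR) :=
  [set p | [/\ 0 < cross p Q S, 0 < cross P p S & 0 < cross P Q p]].

Definition std_triangle : set (mR * mR) :=
  [set p | [/\ 0 < p.1, 0 < p.2 & 0 < 1 - p.1 - p.2]].

(** The affine map of determinant [cross P Q S] that sends (1, 0), (0, 1), (0, 0) to [P], [Q], [S];
    its arguments are thus barycentric coordinates. *)
Definition std_param P Q S p : mR * mR :=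
  (p.1 * P.1 + p.2 * Q.1 + (1 - p.1 - p.2) * S.1,
   p.1 * P.2 + p.2 * Q.2 + (1 - p.1 - p.2) * S.2).

Lemma cross_rot P Q S : cross Q S P = cross P Q S.
Proof. rewrite /cross; ring. Qed.

Lemma open_triangle_rot P Q S : open_triangle Q S P = open_triangle P Q S.
Proof.
rewrite /open_triangle; apply/seteqP; split=> p /= [].
  by rewrite (cross_rot P p S) (cross_rot P Q p) (cross_rot p Q S).
by split; rewrite ?(cross_rot P p S) ?(cross_rot P Q p) ?(cross_rot p Q S).
Qed.

Lemma measurable_affine_gt0 (a b c : R) (A : set (mR * mR)) :
  A = [set p : mR * mR | 0 < a + b * p.1 + c * p.2] -> measurable A.
Proof.
move=> ->; rewrite (_ : [set p | _] =
   setT `&` (fun p : mR * mR => a + b * p.1 + c * p.2) @^-1` `]0, +oo[).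
  exact: measurable_affine.
by rewrite setTI; apply/seteqP; split=> p /=; rewrite in_itv/= andbT.
Qed.

Lemma measurable_open_triangle P Q S : measurable (open_triangle P Q S).
Proof.
rewrite (_ : open_triangle P Q S = [set p | 0 < cross p Q S] `&`
    [set p | 0 < cross P p S] `&` [set p | 0 < cross P Q p]); last first.
  by apply/seteqP; split=> p [] => [? ? ?|[? ?] ?].
apply: measurableI; first apply: measurableI.
- apply: (@measurable_affine_gt0 (Q.1 * S.2 - Q.2 * S.1) (Q.2 - S.2) (S.1 - Q.1)).
  by apply/seteqP; split=> p /=; rewrite /cross; lra.
- apply: (@measurable_affine_gt0 (S.1 * P.2 - S.2 * P.1) (S.2 - P.2) (P.1 - S.1)).
  by apply/seteqP; split=> p /=; rewrite /cross; lra.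
- apply: (@measurable_affine_gt0 (P.1 * Q.2 - P.2 * Q.1) (P.2 - Q.2) (Q.1 - P.1)).
  by apply/seteqP; split=> p /=; rewrite /cross; lra.
Qed.

Lemma std_triangleE : std_triangle = open_triangle (1, 0) (0, 1) (0, 0).
Proof.
by apply/seteqP; split=> p; rewrite /std_triangle /open_triangle /cross/= => -[? ? ?]; split; lra.
Qed.

Lemma std_param_preimage P Q S : 0 < cross P Q S -> std_param P Q S @^-1` open_triangle P Q S = std_triangle.
Proof.
move=> D0; apply/seteqP; split=> p; rewrite /open_triangle /=.
  have -> : cross (std_param P Q S p) Q S = p.1 * cross P Q S by rewrite /cross/=; ring.
  have -> : cross P (std_param P Q S p) S = p.2 * cross P Q S by rewrite /cross/=; ring.
  have -> : cross P Q (std_param P Q S p) = (1 - p.1 - p.2) * cross P Q S by rewrite /cross/=; ring.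
  by rewrite !pmulr_lgt0.
have -> : cross (std_param P Q S p) Q S = p.1 * cross P Q S by rewrite /cross/=; ring.
have -> : cross P (std_param P Q S p) S = p.2 * cross P Q S by rewrite /cross/=; ring.
have -> : cross P Q (std_param P Q S p) = (1 - p.1 - p.2) * cross P Q S by rewrite /cross/=; ring.
by rewrite !pmulr_lgt0.
Qed.

Lemma measurable_std_param P Q S : measurable_fun setT (std_param P Q S).
Proof.
have aff (u v w : R) :
    measurable_fun setT (fun p : mR * mR => p.1 * u + p.2 * v + (1 - p.1 - p.2) * w).
  rewrite (_ : (fun p => _) = (fun p : mR * mR => w + (u - w) * p.1 + (v - w) * p.2)).
    exact: measurable_affine.
  by apply/funext => p; ring.
by apply: measurable_fun_pair; exact: aff.
Qed.

Local Open Scope ereal_scope.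

(* An affine map of the plane is a shear-and-scale of the first coordinate followed by
   one of the second, provided its upper left coefficient is nonzero. *)
Lemma integral_open_triangle_nonvertical P Q S (f : mR * mR -> \bar R) : (0 < cross P Q S)%R ->
  P.1 != S.1 -> measurable_fun setT f -> (forall p, open_triangle P Q S p -> 0 <= f p) ->
  \int[@area R]_(p in open_triangle P Q S) f p =
  (cross P Q S)%:E * \int[@area R]_(p in std_triangle) f (std_param P Q S p).
Proof.
move=> D0 PS mf f0.
have dp0 : (P.1 - S.1 != 0)%R by rewrite subr_eq0.
rewrite integral_mkcond [in RHS]integral_mkcond.
set G := f \_ _.
have G0 p : 0 <= G p by apply: erestrict_ge0.
have mG : measurable_fun setT G.
  apply/(measurable_restrictT _ _).1; first exact: measurable_open_triangle.
  exact: measurable_funTS.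
set p1 := (P.1 - S.1)%R in dp0.
(* The second coordinate is measured from the line through [S] and [P], whence the slope
   [(P.2 - S.2) / p1]. The scale factors [cross P Q S / p1] here and [p1] below multiply to the
   determinant. *)
rewrite (@ge0_integral_shear_snd _ (cross P Q S / p1)
   (fun x => (P.2 - S.2) / p1 * (x - S.1) + S.2)%R)//; last 2 first.
- by rewrite mulf_neq0// ?invr_neq0// gt_eqF.
- apply: measurable_funD => //; apply: measurable_funM => //.
  exact: measurable_funB.
rewrite (@ge0_integral_shear_fst _ p1
   (fun y => (Q.1 - S.1) * y + S.1)%R)//; last 2 first.
- by apply: measurable_funD => //; apply: measurable_funM.
- apply: (measurableT_comp mG (measurable_shear_snd (cross P Q S / p1)
    (_ : measurable_fun setT (fun x : mR => (P.2 - S.2) / p1 * (x - S.1) + S.2)%R))).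
  apply: measurable_funD => //; apply: measurable_funM => //.
  exact: measurable_funB.
rewrite muleA -EFinM -normrM divfK// gtr0_norm//; congr (_ * _).
apply: eq_integral => p _ /=.
rewrite -(std_param_preimage D0) /G/= /patch.
set c := (_, _); have -> : c = std_param P Q S p.
  rewrite /c /std_param /cross; congr (_, _).
    by rewrite /p1; ring.
  by rewrite /p1; field; exact: dp0.
have -> : (p \in std_param P Q S @^-1` open_triangle P Q S) = (std_param P Q S p \in open_triangle P Q S).
  by apply/idP/idP; rewrite !inE.
by [].

Qed.

(** This is the substitution for the reference triangle itself, with its vertices listed in another
    cyclic order and determinant 1. *)
Lemma integral_std_triangle_rot (f : mR * mR -> \bar R) :
  measurable_fun setT f -> (forall p, std_triangle p -> 0 <= f p) ->
  \int[@area R]_(p in std_triangle) f p =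
  \int[@area R]_(p in std_triangle) f (1 - p.1 - p.2, p.1)%R.
Proof.
move=> mf f0.
have e : std_triangle = open_triangle (0, 1)%R (0, 0)%R (1, 0)%R by rewrite -2!open_triangle_rot -std_triangleE.
rewrite {1}e integral_open_triangle_nonvertical//=; first last.
- by rewrite -e.
- by rewrite eq_sym oner_eq0.
- by rewrite /cross/=; lra.
rewrite (_ : cross _ _ _ = 1%R); last by rewrite /cross/=; ring.
rewrite mul1e; apply: eq_integral => p _; congr f.
by rewrite /std_param/=; congr (_, _); ring.
Qed.

(** If [P] and [S] share their abscissa, then [S] and [Q] do not, so the nonvertical case applies
    after a cyclic relabelling; the relabelled parametrization differs by a rotation of the
    reference triangle. *)
Lemma integral_open_triangle P Q S (f : mR * mR -> \bar R) : (0 < cross P Q S)%R ->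
  measurable_fun setT f -> (forall p, open_triangle P Q S p -> 0 <= f p) ->
  \int[@area R]_(p in open_triangle P Q S) f p =
  (cross P Q S)%:E * \int[@area R]_(p in std_triangle) f (std_param P Q S p).
Proof.
move=> D0 mf f0; have [PS|PS] := eqVneq P.1 S.1; last exact: integral_open_triangle_nonvertical.
have SQ : S.1 != Q.1.
  by apply/eqP => SQ; move: D0; rewrite /cross PS SQ; lra.
have D0' : (0 < cross S P Q)%R by rewrite -cross_rot.
rewrite (open_triangle_rot S P Q) integral_open_triangle_nonvertical//; first last.
- by move=> p; rewrite -open_triangle_rot; exact: f0.
rewrite -(cross_rot S P Q); congr (_ * _).
have mfc : measurable_fun setT (fun p => f (std_param S P Q p)).
  exact: (measurableT_comp mf (measurable_std_param S P Q)).
rewrite integral_std_triangle_rot//; last first.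
  move=> p; rewrite -(std_param_preimage D0') => Sp; apply: f0.
  by rewrite (open_triangle_rot S P Q).
apply: eq_integral => p _; congr f.
by rewrite /std_param/=; congr (_, _); ring.
Qed.

End triangles.

(** * Area and mass integrals on the reference triangle *)

Section local_matrices.
Context {R : realType}.
Notation mR := (measurableTypeR R).
Implicit Types P Q S p : mR * mR.

Lemma measurable_std_triangle : measurable (@std_triangle R).
Proof. by rewrite std_triangleE; exact: measurable_open_triangle. Qed.

Lemma area_rect (a b c d : R) : a < b -> c < d ->
  area (`]a, b[ `*` `]c, d[) = ((b - a) * (d - c))%:E.
Proof.
move=> ab cd.
by rewrite /area product_measure1E//= !lebesgue_measure_itv/= !lte_fin ab cd -!EFinB -EFinM.
Qed.

Lemma area_std_triangle_lty : (area (@std_triangle R) < +oo)%E.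
Proof.
apply: (@le_lt_trans _ _ (area (`]0, 1[ `*` `]0, 1[ : set (mR * mR)))).
  apply: le_measure; rewrite ?inE.
  - exact: measurable_std_triangle.
  - exact: measurableX.
  - by move=> [a b] [/= a0 b0 ab]; split => /=; rewrite in_itv/=; apply/andP; split; lra.
by rewrite area_rect// ltry.
Qed.

(** A square inside the triangle and away from the axes and the diagonal: on it [p.1 * p.2] exceeds
    3/64 and [(p.1 - p.2) ^+ 2] exceeds 1/64, the source of the bound 1/64 below. *)
Definition std_square : set (mR * mR) := `](1 / 8), (1 / 4)[ `*` `](3 / 8), (1 / 2)[.

Lemma std_square_sub : std_square `<=` @std_triangle R.
Proof.
by move=> [a b] [/=]; rewrite !in_itv/= => /andP[a1 a2] /andP[b1 b2]; split=> /=; lra.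
Qed.

Lemma integrable_std_triangle (f : mR * mR -> R) : measurable_fun setT f ->
  (forall p, std_triangle p -> `|f p| <= 2) -> (@area R).-integrable std_triangle (EFin \o f).
Proof.
move=> mf f1; apply: measurable_bounded_integrable.
- exact: measurable_std_triangle.
- exact: area_std_triangle_lty.
- exact: measurable_funTS.
- by exists 2; split=> [|x x1 p sp]; [exact: num_real|exact: le_trans (f1 p sp) (ltW x1)].
Qed.

(** The bound on the square makes the extended integral positive, and the upper bound makes it
    finite, so that [fine] does not send it to 0. *)
Lemma Rintegral_std_triangle_gt0 (f : mR * mR -> R) : measurable_fun setT f ->
  (forall p, std_triangle p -> 0 <= f p <= 2) -> (forall p, std_square p -> 1 / 64 <= f p) ->
  0 < \int[@area R]_(p in std_triangle) f p.
Proof.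
move=> mf f0 fs.
have If := integrable_std_triangle mf.
rewrite /Rintegral fine_gt0//.
have mef : measurable_fun setT (fun p => (f p)%:E) by exact/measurable_EFinP.
have msm : measurable std_square by exact: measurableX.
apply/andP; split; last first.
  apply/integrable_lty => //; first exact: measurable_std_triangle.
  by apply: If => p /f0/andP[? ?]; rewrite ger0_norm.
apply: (@lt_le_trans _ _ (\int[@area R]_(p in std_square) (1 / 64)%:E)%E).
  rewrite integral_cst// -[X in (_ < _ * X)%E]/(area std_square) /std_square area_rect; [|lra|lra].
  by rewrite -EFinM lte_fin; lra.
apply: (@le_trans _ _ (\int[@area R]_(p in std_square) (f p)%:E)%E).
  apply: ge0_le_integral => //.
  exact: measurable_funTS.
apply: ge0_subset_integral => //.
- exact: measurable_std_triangle.
- exact: measurable_funTS.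
- by move=> p /f0/andP[? _]; rewrite lee_fin.
- exact: std_square_sub.
Qed.

(* The values are 1/12 and 1/24 (and 1/2 for [std_area]); only
   [0 < std_mass false < std_mass true] and [0 < std_area] matter. *)
Definition std_mass (b : bool) : R :=
  \int[@area R]_(p in std_triangle) (p.1 * (if b then p.1 else p.2)).

Definition std_area : R := \int[@area R]_(p in std_triangle) 1.

Lemma std_area_gt0 : 0 < std_area.
Proof. by apply: Rintegral_std_triangle_gt0 => // p _; lra. Qed.

Lemma std_mass_off_gt0 : 0 < std_mass false.
Proof.
apply: Rintegral_std_triangle_gt0 => /=.
- by apply: measurable_funM.
- by move=> [a b] [/= a0 b0 ab]; nra.
- by move=> [a b] [/=]; rewrite !in_itv/= => /andP[a1 a2] /andP[b1 b2]; nra.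
Qed.

Definition std_coord (k : nat) p : R := nth 0 [:: p.1; p.2; 1 - p.1 - p.2] k.

Lemma measurable_std_coord k : measurable_fun setT (std_coord k).
Proof.
case: k => [|[|[|k]]]; rewrite /std_coord/=.
- exact: measurable_fst.
- exact: measurable_snd.
- rewrite (_ : (fun p => _) = (fun p : mR * mR => 1 + (-1) * p.1 + (-1) * p.2)).
    exact: measurable_affine.
  by apply/funext => p; ring.
- rewrite (_ : (fun p => _) = cst 0); first exact: measurable_cst.
  by apply/funext => p; rewrite nth_nil.
Qed.

Lemma std_coord01 k p : std_triangle p -> 0 <= std_coord k p <= 1.
Proof.
case: p => a b [/= a0 b0 ab].
by case: k => [|[|[|k]]]; rewrite /std_coord/= ?nth_nil; lra.
Qed.

Lemma integrable_std_coord i j :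
  (@area R).-integrable std_triangle (fun p => (std_coord i p * std_coord j p)%:E).
Proof.
apply: integrable_std_triangle; first by apply: measurable_funM; exact: measurable_std_coord.
move=> p sp; have := std_coord01 i sp; have := std_coord01 j sp.
by move=> ? ?; rewrite ger0_norm; nra.
Qed.

(** Rotating the reference triangle permutes its three coordinates cyclically, so with symmetry
    every pair reduces to (0, 0) or (0, 1). *)
Lemma Rintegral_std_coord i j : (i < 3)%N -> (j < 3)%N ->
  \int[@area R]_(p in std_triangle) (std_coord i p * std_coord j p) = std_mass (i == j).
Proof.
have mc k l : measurable_fun setT (fun p => (std_coord k p * std_coord l p)%:E).
  by apply/measurable_EFinP; apply: measurable_funM; exact: measurable_std_coord.
have c0 k l p : std_triangle p -> (0 <= (std_coord k p * std_coord l p)%:E)%E.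
  by move=> sp; have := std_coord01 k sp; have := std_coord01 l sp; rewrite lee_fin; nra.
have rot (k l k' l' : nat) : (forall p, std_coord k (1 - p.1 - p.2, p.1) = std_coord k' p) ->
    (forall p, std_coord l (1 - p.1 - p.2, p.1) = std_coord l' p) ->
    \int[@area R]_(p in std_triangle) (std_coord k p * std_coord l p) =
    \int[@area R]_(p in std_triangle) (std_coord k' p * std_coord l' p).
  move=> h h'; rewrite /Rintegral integral_std_triangle_rot//; last exact: c0.
  by congr fine; apply: eq_integral => p _; rewrite h h'.
have r0 p : std_coord 0 (1 - p.1 - p.2, p.1) = std_coord 2 p by [].
have r1 p : std_coord 1 (1 - p.1 - p.2, p.1) = std_coord 0 p by [].
have r2 p : std_coord 2 (1 - p.1 - p.2, p.1) = std_coord 1 p by rewrite /std_coord/=; ring.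
have e00 : \int[@area R]_(p in std_triangle) (std_coord 0 p * std_coord 0 p) = std_mass true by [].
have e01 : \int[@area R]_(p in std_triangle) (std_coord 0 p * std_coord 1 p) = std_mass false by [].
have e20 : \int[@area R]_(p in std_triangle) (std_coord 2 p * std_coord 0 p) = std_mass false.
  by rewrite -e01; apply/esym; exact: rot.
have e12 : \int[@area R]_(p in std_triangle) (std_coord 1 p * std_coord 2 p) = std_mass false.
  by rewrite -e20; apply/esym; exact: rot.
have sym k l : \int[@area R]_(p in std_triangle) (std_coord k p * std_coord l p) =
    \int[@area R]_(p in std_triangle) (std_coord l p * std_coord k p).
  by apply: eq_Rintegral => p _; rewrite mulrC.
have e22 : \int[@area R]_(p in std_triangle) (std_coord 2 p * std_coord 2 p) = std_mass true.
  by rewrite -e00; apply/esym; exact: rot.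
have e11 : \int[@area R]_(p in std_triangle) (std_coord 1 p * std_coord 1 p) = std_mass true.
  by rewrite -e22; apply/esym; exact: rot.
by case: i => [|[|[|i]]] //; case: j => [|[|[|j]]] // _ _; rewrite // sym.
Qed.

(** The positive integral of [(p.1 - p.2) ^+ 2] equals twice the difference of the two masses. *)
Lemma std_mass_lt : std_mass false < std_mass true.
Proof.
have h : 0 < \int[@area R]_(p in std_triangle) (p.1 - p.2) ^+ 2.
  apply: Rintegral_std_triangle_gt0.
  - by apply: measurable_funX; apply: measurable_funB.
  - by move=> [a b] [/= a0 b0 ab]; rewrite sqr_ge0/= expr2; nra.
  - by move=> [a b] [/=]; rewrite !in_itv/= => /andP[a1 a2] /andP[b1 b2]; rewrite expr2; nra.
have I := integrable_std_coord.
have e : \int[@area R]_(p in std_triangle) ((p.1 - p.2) ^+ 2 + 2 * (p.1 * p.2)) =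
   \int[@area R]_(p in std_triangle) (std_coord 0 p * std_coord 0 p + std_coord 1 p * std_coord 1 p).
  by apply: eq_Rintegral => p _; rewrite /std_coord/=; ring.
have mstd := measurable_std_triangle.
move: e; rewrite [RHS]RintegralD//; [|exact: (I 0 0)%N|exact: (I 1 1)%N].
rewrite !Rintegral_std_coord// RintegralD//; last 2 first.
- apply: integrable_std_triangle.
    by apply: measurable_funX; apply: measurable_funB.
  by move=> [a b] [/= a0 b0 ab]; rewrite ger0_norm ?sqr_ge0//= expr2; nra.
- apply: integrable_std_triangle.
    by apply: measurable_funM => //; apply: measurable_funM.
  by move=> [a b] [/= a0 b0 ab]; rewrite ger0_norm; nra.
rewrite RintegralZl//; last exact: (I 0 1)%N.
rewrite (_ : \int[@area R]_(x in std_triangle) (x.1 * x.2) = std_mass false)//.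
by move=> e; lra.
Qed.

(** Barycentric coordinates as ratios of areas. The default of [nth] makes [k = 3] give 0, so [bary]
    at [index n t] is also right when [n] is not a vertex of [t]. *)
Definition bary P Q S (k : nat) p : R :=
  nth 0 [:: cross p Q S; cross P p S; cross P Q p] k / cross P Q S.

Lemma bary_std_param P Q S k p : 0 < cross P Q S -> (k < 3)%N ->
  bary P Q S k (std_param P Q S p) = std_coord k p.
Proof.
move=> D0; have Dn0 : cross P Q S != 0 by rewrite gt_eqF.
case: k => [|[|[|k]]] // _; rewrite /bary /std_coord /=;
  apply: (mulIf Dn0); rewrite divfK// /cross/=; ring.
Qed.

Lemma measurable_bary P Q S k : measurable_fun setT (bary P Q S k).
Proof.
apply: measurable_funM => //.
have aff (a b c : R) (f : mR * mR -> R) :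
    (forall p, f p = a + b * p.1 + c * p.2) -> measurable_fun setT f.
  by move=> h; rewrite (funext h); exact: measurable_affine.
case: k => [|[|[|k]]] /=.
- apply: (aff (Q.1 * S.2 - Q.2 * S.1) (Q.2 - S.2) (S.1 - Q.1)) => p.
  by rewrite /cross; ring.
- apply: (aff (S.1 * P.2 - S.2 * P.1) (S.2 - P.2) (P.1 - S.1)) => p.
  by rewrite /cross; ring.
- apply: (aff (P.1 * Q.2 - P.2 * Q.1) (P.2 - Q.2) (Q.1 - P.1)) => p.
  by rewrite /cross; ring.
- rewrite (_ : (fun p => _) = cst 0); first exact: measurable_cst.
  by apply/funext => p; rewrite nth_nil.
Qed.

Lemma bary_gt0 P Q S k p : 0 < cross P Q S -> (k < 3)%N -> open_triangle P Q S p ->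
  0 < bary P Q S k p.
Proof.
by move=> D0 + [? ? ?]; case: k => [|[|[|k]]] // _; rewrite /bary/= divr_gt0.
Qed.

Lemma integral_open_triangle_bary P Q S i j : 0 < cross P Q S -> (i < 3)%N -> (j < 3)%N ->
  (\int[@area R]_(p in open_triangle P Q S) (bary P Q S i p * bary P Q S j p)%:E =
  (cross P Q S * std_mass (i == j))%:E)%E.
Proof.
move=> D0 i3 j3; rewrite integral_open_triangle//; last 2 first.
- by apply/measurable_EFinP; apply: measurable_funM; exact: measurable_bary.
- by move=> p tp; rewrite lee_fin mulr_ge0// ltW// bary_gt0.
rewrite EFinM; congr (_ * _)%E; rewrite -Rintegral_std_coord// /Rintegral fineK.
  by apply: eq_integral => p _; rewrite !bary_std_param.
apply: integrable_fin_num; first exact: measurable_std_triangle.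
exact: integrable_std_coord.
Qed.

Lemma area_open_triangle P Q S : 0 < cross P Q S ->
  area (open_triangle P Q S) = (cross P Q S * std_area)%:E.
Proof.
move=> D0; rewrite -[LHS]mul1e -integral_cst; last exact: measurable_open_triangle.
rewrite integral_open_triangle// EFinM; congr (_ * _)%E.
rewrite /std_area /Rintegral fineK//; apply: integrable_fin_num.
  exact: measurable_std_triangle.
by apply: integrable_std_triangle => // p _; rewrite normr1; lra.
Qed.

End local_matrices.

(** * The mesh *)

Section coordinates.
Context {R : realType}.
Notation s := (Num.sqrt 3 : R).

Lemma sqrt3_sqr : s * s = 3.
Proof. by rewrite -expr2 sqr_sqrtr// ler0n. Qed.

Lemma sqrt3_gt : 17 / 10 < s.
Proof.
have s0 : 0 <= s by exact: sqrtr_ge0.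
by have := sqrt3_sqr; nra.
Qed.

Lemma sqrt3_lt : s < 18 / 10.
Proof.
have s0 : 0 <= s by exact: sqrtr_ge0.
by have := sqrt3_sqr; nra.
Qed.

(** Doubling the angle gives its supplement, so the cosine c satisfies 2 c^2 - 1 = - c; positivity
    excludes the root -1. *)
Lemma cos_pi_div3 : cos (pi / 3) = 1 / 2 :> R.
Proof.
have c0 : 0 < cos (pi / 3 : R).
  by apply: cos_gt0_pihalf; have := @pi_gt0 R => pi0; apply/andP; split; lra.
have : cos (pi / 3 *+ 2) = - cos (pi / 3) :> R.
  rewrite (_ : pi / 3 *+ 2 = pi - pi / 3); last by rewrite mulr2n; field.
  by rewrite cosB cospi sinpi; ring.
rewrite cos_mulr2n => h; nra.
Qed.

Lemma sin_pi_div3 : sin (pi / 3) = s / 2 :> R.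
Proof.
have s0 : 0 < sin (pi / 3 : R).
  by apply: sin_gt0_pi; have := @pi_gt0 R => pi0; apply/andP; split; lra.
have := cos2Dsin2 (pi / 3 : R); rewrite cos_pi_div3 => h.
have := sqrt3_sqr; have := sqrt3_gt => *; nra.
Qed.

Lemma cos_pi_div6 : cos (pi / 6) = s / 2 :> R.
Proof.
rewrite (_ : pi / 6 = pi / 2 - pi / 3); last by field.
by rewrite cosB cos_pihalf sin_pihalf sin_pi_div3; ring.
Qed.

Lemma sin_pi_div6 : sin (pi / 6) = 1 / 2 :> R.
Proof.
rewrite (_ : pi / 6 = pi / 2 - pi / 3); last by field.
by rewrite sinB cos_pihalf sin_pihalf cos_pi_div3; ring.
Qed.

Lemma cos_sin_pi_div3M (j : nat) : (j < 6)%N ->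
  cos (j%:R * pi / 3) = nth 0 [:: 1; 1 / 2; - (1 / 2); -1; - (1 / 2); 1 / 2] j :> R
  /\ sin (j%:R * pi / 3) = nth 0 [:: 0; s / 2; s / 2; 0; - (s / 2); - (s / 2)] j :> R.
Proof.
have rot (i : nat) (c z : R) :
    cos (i%:R * pi / 3 : R) = c /\ sin (i%:R * pi / 3 : R) = z ->
    cos (i.+1%:R * pi / 3 : R) = c / 2 - z * s / 2 /\
    sin (i.+1%:R * pi / 3 : R) = z / 2 + c * s / 2.
  move=> [hc hz].
  rewrite (_ : i.+1%:R * pi / 3 = i%:R * pi / 3 + pi / 3); last by rewrite -natr1; field.
  rewrite cosD sinD hc hz cos_pi_div3 sin_pi_div3; split; ring.
have h3 := sqrt3_sqr.
have h0 : cos (0%:R * pi / 3 : R) = 1 /\ sin (0%:R * pi / 3 : R) = 0.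
  by rewrite !mul0r cos0 sin0.
have step (i : nat) (c z c' z' : R) :
    cos (i%:R * pi / 3 : R) = c /\ sin (i%:R * pi / 3 : R) = z ->
    c / 2 - z * s / 2 = c' -> z / 2 + c * s / 2 = z' ->
    cos (i.+1%:R * pi / 3 : R) = c' /\ sin (i.+1%:R * pi / 3 : R) = z'.
  by move=> /rot + <- <-.
have h1 : cos (1%:R * pi / 3 : R) = 1 / 2 /\ sin (1%:R * pi / 3 : R) = s / 2.
  by apply: (step _ _ _ _ _ h0); ring.
have h2 : cos (2%:R * pi / 3 : R) = - (1 / 2) /\ sin (2%:R * pi / 3 : R) = s / 2.
  by apply: (step _ _ _ _ _ h1); lra.
have h4 : cos (3%:R * pi / 3 : R) = - 1 /\ sin (3%:R * pi / 3 : R) = 0.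
  by apply: (step _ _ _ _ _ h2); lra.
have h5 : cos (4%:R * pi / 3 : R) = - (1 / 2) /\ sin (4%:R * pi / 3 : R) = - (s / 2).
  by apply: (step _ _ _ _ _ h4); lra.
have h6 : cos (5%:R * pi / 3 : R) = 1 / 2 /\ sin (5%:R * pi / 3 : R) = - (s / 2).
  by apply: (step _ _ _ _ _ h5); lra.
by case: j => [|[|[|[|[|[|]]]]]].
Qed.

(** The first entry is a dummy, since nodes are numbered from 1. *)
Definition node_coord (d : R) (n : nat) : R * R :=
  nth (0, 0) [:: (0, 0); (0, 0);
    (1, 0); (1 / 2, s / 2); (- (1 / 2), s / 2);
    (-1, 0); (- (1 / 2), - (s / 2)); (1 / 2, - (s / 2));
    (d * s / 2, - (d / 2)); (d * s / 2, d / 2); (0, d);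
    (- (d * s / 2), d / 2); (- (d * s / 2), - (d / 2)); (0, - d)] n.

Lemma nodeE (d : R) (n : nat) : (0 < n <= 13)%N -> node d n = node_coord d n.
Proof.
have inner (j : nat) : (j < 6)%N -> node d j.+2 =
    (cos (j%:R * pi / 3), sin (j%:R * pi / 3)).
  by move=> j6; rewrite /node (_ : (j.+2 <= 7)%N) // subn2.
have outer (k : nat) : (k < 6)%N -> node d (8 + k) =
    (d * (cos (k%:R * pi / 3) * (s / 2) + sin (k%:R * pi / 3) * (1 / 2)),
     d * (sin (k%:R * pi / 3) * (s / 2) - cos (k%:R * pi / 3) * (1 / 2))).
  move=> k6; rewrite /node/= addKn.
  rewrite (_ : (2 * k%:R - 1) * pi / 6 = k%:R * pi / 3 - pi / 6); last by field.
  by rewrite cosB sinB cos_pi_div6 sin_pi_div6.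
have h3 := sqrt3_sqr.
case: n => // n; case: n => [_|n]; first by rewrite /node.
rewrite ltnS andTb => n12; have [n6|] := ltnP n 6.
  have [hc hs] := cos_sin_pi_div3M n6.
  rewrite inner// hc hs.
  by case: n n6 {n12 hc hs} => [|[|[|[|[|[|]]]]]].
(* [lra] treats monomials as atoms, so the relation [s * s = 3] is supplied multiplied by the
   factors that occur. *)
have hd3 : d * (s * s) = d * 3 by rewrite h3.
move=> n6; have k6 : (n - 6 < 6)%N by rewrite ltn_subLR.
have [hc hs] := cos_sin_pi_div3M k6.
rewrite (_ : n.+2 = 8 + (n - 6))%N; last by rewrite -[8%N]/(2 + 6)%N -addnA subnKC.
rewrite outer// hc hs.
case: (n - 6)%N k6 => [|[|[|[|[|[|]]]]]] //= _; rewrite /node_coord/=; congr (_, _); lra.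
Qed.

End coordinates.

(* The triangles of [mesh] with two inner vertices and one outer vertex are listed
   clockwise; here every triangle is listed counterclockwise. *)
Definition ccw_mesh : seq (seq nat) :=
  [seq [:: 1%N; inner_node k; inner_node k.+1] | k <- iota 0 6]
  ++ [seq [:: inner_node k.+1; inner_node k; outer_node k.+1] | k <- iota 0 6]
  ++ [seq [:: outer_node k; outer_node k.+1; inner_node k] | k <- iota 0 6].

Lemma ccw_mesh_perm t : t \in ccw_mesh -> exists2 t', t' \in mesh & perm_eq t' t.
Proof.
have /allP h : all (fun t => has (perm_eq^~ t) mesh) ccw_mesh by vm_compute.
by move=> /h /hasP.
Qed.

Lemma ccw_mesh_vertices t : t \in ccw_mesh ->
  exists a b c, [/\ t = [:: a; b; c], uniq t & {in t, forall n, (0 < n <= 13)%N}].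
Proof.
have /allP h : all (fun t => [&& size t == 3%N, uniq t & all (fun n => (0 < n <= 13)%N) t])
  ccw_mesh by vm_compute.
move=> /h /and3P[]; case: t => [|a [|b [|c []]]]// _ u /allP v.
by exists a, b, c.
Qed.

Lemma ccw_mesh_inj t t' : t \in ccw_mesh -> t' \in ccw_mesh ->
  {subset t <= t'} -> t = t'.
Proof.
have /allP h : all (fun t => all (fun t' => all (mem t') t ==> (t == t')) ccw_mesh)
  ccw_mesh by vm_compute.
by move=> /h /allP{}h /h /implyP{}h tt'; apply/eqP/h/allP.
Qed.

Section mesh_geometry.
Context {R : realType}.
Notation s := (Num.sqrt 3 : R).
Variable d : R.
Hypothesis hd : 1 + Num.sqrt 3 <= d.

Definition mesh_triangle (t : seq nat) : set (R * R) :=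
  open_triangle (node d (nth 0%N t 0)) (node d (nth 0%N t 1)) (node d (nth 0%N t 2)).

Definition triangle_det (t : seq nat) : R :=
  cross (node d (nth 0%N t 0)) (node d (nth 0%N t 1)) (node d (nth 0%N t 2)).

(* Out of range, [k = 3] gives the zero vector; this is the value [index n t] takes
   when [n] is not a vertex of [t]. *)
Definition edge (t : seq nat) (k : nat) : R * R :=
  let P := node d (nth 0%N t 0) in
  let Q := node d (nth 0%N t 1) in
  let S := node d (nth 0%N t 2) in
  nth (0, 0) [:: (S.1 - Q.1, S.2 - Q.2); (P.1 - S.1, P.2 - S.2); (Q.1 - P.1, Q.2 - P.2)] k.

Definition gram_table (t : seq (seq R)) (i j : nat) : R := nth 0 (nth [::] t i) j.

(** The gradient of a barycentric coordinate is the opposite edge turned by a right angle and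
    divided by [triangle_det]. Dot products of edges therefore determine the local stiffness
    matrices. *)
Definition gram_center := gram_table
  [:: [:: 1; - (1 / 2); - (1 / 2)]; [:: - (1 / 2); 1; - (1 / 2)];
      [:: - (1 / 2); - (1 / 2); 1]].

(** [h] is the height of the triangle over its inner-ring edge, which has length 1 and distance
    [s / 2] from the origin. *)
Definition gram_middle :=
  let h := d - s / 2 in
  gram_table [:: [:: h * h + 1 / 4; 1 / 4 - h * h; - (1 / 2)];
    [:: 1 / 4 - h * h; h * h + 1 / 4; - (1 / 2)]; [:: - (1 / 2); - (1 / 2); 1]].

(** [h] is the height over the outer edge of length [d]: the apothem [d * s / 2] of the hexagon
    minus the radius 1 of the inner ring. *)
Definition gram_outer :=
  let h := d * s / 2 - 1 in
  gram_table [:: [:: h * h + d * d / 4; d * d / 4 - h * h; - (d * d / 2)];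
    [:: d * d / 4 - h * h; h * h + d * d / 4; - (d * d / 2)];
    [:: - (d * d / 2); - (d * d / 2); d * d]].

Lemma mesh_center k : (k < 6)%N ->
  let t := [:: 1%N; inner_node k; inner_node k.+1] in
  triangle_det t = s / 2 /\ forall i j, dot (edge t i) (edge t j) = gram_center i j.
Proof.
have h3 := @sqrt3_sqr R.
case: k => [|[|[|[|[|[|k]]]]]] //= _; (split;
  [by rewrite /triangle_det !nodeE// /node_coord /cross/=; lra|];
  case=> [|[|[|i]]]; case=> [|[|[|j]]];
  rewrite /dot /edge !nodeE// /gram_center /gram_table /node_coord /= ?nth_nil/= ?nth_nil/=; lra).
Qed.

Lemma mesh_middle k : (k < 6)%N ->
  let t := [:: inner_node k.+1; inner_node k; outer_node k.+1] in
  triangle_det t = d - s / 2 /\ forall i j, dot (edge t i) (edge t j) = gram_middle i j.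
Proof.
have h3 := @sqrt3_sqr R.
have hd3 : d * (s * s) = d * 3 by rewrite h3.
have hdd3 : d * d * (s * s) = d * d * 3 by rewrite h3.
case: k => [|[|[|[|[|[|k]]]]]] //= _; (split;
  [by rewrite /triangle_det !nodeE// /node_coord /cross/=; lra|];
  case=> [|[|[|i]]]; case=> [|[|[|j]]];
  rewrite /dot /edge !nodeE// /gram_middle /gram_table /node_coord /= ?nth_nil/= ?nth_nil/=; lra).
Qed.

Lemma mesh_outer k : (k < 6)%N ->
  let t := [:: outer_node k; outer_node k.+1; inner_node k] in
  triangle_det t = d * (d * s / 2 - 1) /\ forall i j, dot (edge t i) (edge t j) = gram_outer i j.
Proof.
have h3 := @sqrt3_sqr R.
have hd3 : d * (s * s) = d * 3 by rewrite h3.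
have hdd3 : d * d * (s * s) = d * d * 3 by rewrite h3.
case: k => [|[|[|[|[|[|k]]]]]] //= _; (split;
  [by rewrite /triangle_det !nodeE// /node_coord /cross/=; lra|];
  case=> [|[|[|i]]]; case=> [|[|[|j]]];
  rewrite /dot /edge !nodeE// /gram_outer /gram_table /node_coord /= ?nth_nil/= ?nth_nil/=; lra).
Qed.

End mesh_geometry.

Section open_triangles.
Context {R : realType}.
Implicit Types P Q S p : R * R.

Lemma continuous_affine (a b c : R) :
  continuous (fun p : R * R => a + b * p.1 + c * p.2).
Proof.
move=> p; apply: cvgD.
  apply: cvgD; first exact: cvg_cst.
  by apply: cvgM; [exact: cvg_cst|exact: cvg_fst].
by apply: cvgM; [exact: cvg_cst|exact: cvg_snd].
Qed.

Lemma open_affine_gt0 (a b c : R) (A : set (R * R)) :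
  (forall p, A p <-> 0 < a + b * p.1 + c * p.2) -> open A.
Proof.
move=> AE; rewrite (_ : A = (fun p : R * R => a + b * p.1 + c * p.2) @^-1` [set x | x > 0]).
  apply: open_comp; last exact: open_gt.
  by move=> p _; exact: continuous_affine.
by apply/seteqP; split=> p /=; rewrite AE.
Qed.

Lemma open_open_triangle P Q S : open (open_triangle P Q S : set (R * R)).
Proof.
rewrite (_ : open_triangle P Q S = [set p | 0 < cross p Q S] `&`
    [set p | 0 < cross P p S] `&` [set p | 0 < cross P Q p]); last first.
  by apply/seteqP; split=> p [] => [? ? ?|[? ?] ?].
apply: openI; first apply: openI.
- apply: (@open_affine_gt0 (Q.1 * S.2 - Q.2 * S.1) (Q.2 - S.2) (S.1 - Q.1)) => p.
  by rewrite /= /cross; split; lra.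
- apply: (@open_affine_gt0 (S.1 * P.2 - S.2 * P.1) (S.2 - P.2) (P.1 - S.1)) => p.
  by rewrite /= /cross; split; lra.
- apply: (@open_affine_gt0 (P.1 * Q.2 - P.2 * Q.1) (P.2 - Q.2) (Q.1 - P.1)) => p.
  by rewrite /= /cross; split; lra.
Qed.

Lemma derive_affine (f : R * R -> R) (a b c : R) (U : set (R * R)) (p v : R * R) :
  open U -> U p -> (forall q, U q -> f q = a + b * q.1 + c * q.2) ->
  'D_v f p = b * v.1 + c * v.2.
Proof.
move=> oU Up fU; apply: cvg_lim => //; apply: cvg_near_cst.
have c0 : (fun h : R => h *: v + p) @ 0 --> p.
  have : (fun h : R => h *: v + p) @ 0 --> 0 *: v + p.
    by apply: cvgD; [apply: cvgZ; [exact: cvg_id|exact: cvg_cst]|exact: cvg_cst].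
  by rewrite scale0r add0r.
near=> h.
have h0 : h != 0 by near: h; exact: nbhs_dnbhs_neq.
rewrite /= !fU//; last first.
  near: h; apply: nbhs_dnbhs; apply: c0.
  exact: open_nbhs_nbhs.
rewrite (_ : (h *: v + p).1 = h * v.1 + p.1)// (_ : (h *: v + p).2 = h * v.2 + p.2)//.
by rewrite /GRing.scale/=; field.
Unshelve. all: by end_near.
Qed.

End open_triangles.

(** * Basis functions as barycentric coordinates on the open triangles *)

Section hulls.
Context {R : realType}.
Notation s := (Num.sqrt 3 : R).
Variable d : R.
Hypothesis hd : 1 + s <= d.

Lemma ccw_meshP t : t \in ccw_mesh -> exists2 k, (k < 6)%N &
  [\/ t = [:: 1%N; inner_node k; inner_node k.+1],
      t = [:: inner_node k.+1; inner_node k; outer_node k.+1] |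
      t = [:: outer_node k; outer_node k.+1; inner_node k]].
Proof.
rewrite !mem_cat => /or3P[] /mapP[k]; rewrite mem_iota add0n => /= k6 ->;
  exists k => //; by [constructor 1|constructor 2|constructor 3].
Qed.

Lemma triangle_det_gt0 t : t \in ccw_mesh -> 0 < triangle_det d t.
Proof.
have s1 := @sqrt3_gt R; have s2 := @sqrt3_lt R; have hd1 := hd.
move=> /ccw_meshP[k k6 [] ->].
- by rewrite (mesh_center d k6).1; lra.
- by rewrite (mesh_middle d k6).1; lra.
- by rewrite (mesh_outer d k6).1; apply: mulr_gt0; [lra|nra].
Qed.

Lemma node_hull_perm t t' : perm_eq t t' -> node_hull d t = node_hull d t'.
Proof.
move=> tt'; apply/seteqP; split=> p [w [w0 w1 ->]]; exists w; split=> //.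
- by rewrite -(perm_big _ tt').
- by rewrite (perm_big _ tt').
- by rewrite (perm_big _ tt').
- by rewrite -(perm_big _ tt').
Qed.

Lemma node_in_hull t n : uniq t -> n \in t -> node_hull d t (node d n).
Proof.
move=> ut nt; exists (fun m => (m == n)%:R); split=> [m||].
- exact: ler0n.
- rewrite (bigD1_seq n)//= eqxx big1 ?addr0// => m /negPf ->//.
- rewrite (bigD1_seq n)//= eqxx scale1r big1 ?addr0// => m /negPf ->.
  by rewrite scale0r.
Qed.

Lemma bary_sum (P Q S p : R * R) : cross P Q S != 0 ->
  bary P Q S 0 p + bary P Q S 1 p + bary P Q S 2 p = 1.
Proof.
move=> D0; rewrite /bary/= -!mulrDl; apply: (mulIf D0); rewrite divfK// mul1r.
by rewrite /cross; ring.
Qed.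

Lemma affine_bary (a b c : R) (P Q S p : R * R) : cross P Q S != 0 ->
  a + b * p.1 + c * p.2 = (a + b * P.1 + c * P.2) * bary P Q S 0 p +
    (a + b * Q.1 + c * Q.2) * bary P Q S 1 p +
    (a + b * S.1 + c * S.2) * bary P Q S 2 p.
Proof.
move=> D0; rewrite /bary/= !mulrA -!mulrDl; apply: (mulIf D0); rewrite divfK//.
by rewrite /cross; ring.
Qed.

Lemma bary3 (P Q S p : R * R) : bary P Q S 3 p = 0.
Proof. by rewrite /bary/= mul0r. Qed.

Lemma index_uniq3 (a b c : nat) : uniq [:: a; b; c] ->
  [/\ index a [:: a; b; c] = 0%N, index b [:: a; b; c] = 1%N &
      index c [:: a; b; c] = 2%N].
Proof.
rewrite /= !inE negb_or andbT => /andP[/andP[/negPf ab /negPf ac] /negPf bc].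
by rewrite eqxx ab ac bc !eqxx.
Qed.

Lemma bary_index_ge0 t n p : t \in ccw_mesh -> mesh_triangle d t p ->
  0 <= bary (node d (nth 0%N t 0)) (node d (nth 0%N t 1)) (node d (nth 0%N t 2)) (index n t) p.
Proof.
move=> tm tp; have [a [b [c [te ut tn]]]] := ccw_mesh_vertices tm.
have : (index n t <= 3)%N by rewrite (leq_trans (index_size _ _))// te.
rewrite leq_eqVlt => /predU1P[->|i3]; first by rewrite bary3.
by apply/ltW/bary_gt0 => //; exact: (triangle_det_gt0 tm).
Qed.

Lemma mesh_triangle_hull t : t \in ccw_mesh -> mesh_triangle d t `<=` node_hull d t.
Proof.
move=> tm p tp; have [a [b [c [te ut tn]]]] := ccw_mesh_vertices tm.
have Dn0 : triangle_det d t != 0 by rewrite gt_eqF// triangle_det_gt0.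
exists (fun n => bary (node d (nth 0%N t 0)) (node d (nth 0%N t 1))
  (node d (nth 0%N t 2)) (index n t) p).
split=> [n||]; first exact: bary_index_ge0.
  rewrite te in ut Dn0 *; rewrite !big_cons big_nil; have [-> -> ->] := index_uniq3 ut.
  by rewrite addr0 addrA bary_sum.
rewrite te in ut Dn0 *; rewrite !big_cons big_nil.
have [-> -> ->] := index_uniq3 ut.
have h1 := affine_bary 0 1 0 p Dn0.
have h2 := affine_bary 0 0 1 p Dn0.
move: h1 h2; rewrite /= !mul0r !add0r !mul1r !addr0 => h1 h2.
rewrite [LHS]surjective_pairing h1 h2.
rewrite [RHS]surjective_pairing /=; congr (_, _); rewrite /GRing.scale/=.
  by rewrite addrA ![_ * bary _ _ _ _ _]mulrC.
by rewrite addrA ![_ * bary _ _ _ _ _]mulrC.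
Qed.

Lemma bary_grad t k : (k <= 3)%N -> triangle_det d t != 0 ->
  let B := bary (node d (nth 0%N t 0)) (node d (nth 0%N t 1)) (node d (nth 0%N t 2)) k in
  B (1, 0) - B (0, 0) = - (edge d t k).2 / triangle_det d t /\
  B (0, 1) - B (0, 0) = (edge d t k).1 / triangle_det d t.
Proof.
move=> k3 D0 B; rewrite /B /bary -!mulrBl -/(triangle_det d t).
split; congr (_ / _); rewrite /edge;
  case: k k3 {B} => [|[|[|[|]]]] //= _; rewrite ?subrr ?oppr0 // /cross /=; ring.
Qed.

Variable phi : 'I_(7 + 6) -> R * R -> R.
Hypothesis hphi : nodal_basis d phi.

(** An affine function is determined by its values at the vertices, here 0 or 1. The second clause
    is an identity on the whole plane, so the partial derivatives can be read off at (0, 0), (1, 0)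
    and (0, 1), whether or not these lie in the triangle. *)
Lemma phi_affine i t : t \in ccw_mesh -> exists a b c : R,
  (forall p, mesh_triangle d t p -> phi i p = a + b * p.1 + c * p.2) /\
  (forall p, a + b * p.1 + c * p.2 =
    bary (node d (nth 0%N t 0)) (node d (nth 0%N t 1)) (node d (nth 0%N t 2))
      (index i.+1 t) p).
Proof.
move=> tm; have [a [b [c [te ut tn]]]] := ccw_mesh_vertices tm.
have Dn0 : triangle_det d t != 0 by rewrite gt_eqF// triangle_det_gt0.
have [t' t'm tt'] := ccw_mesh_perm tm.
have [_ /(_ _ t'm)[x [y [z phiE]]] nodal] := hphi i.
rewrite (node_hull_perm tt') in phiE.
exists x, y, z; split=> [p tp|p]; first by apply: phiE; exact: mesh_triangle_hull.
have val n : n \in t -> x + y * (node d n).1 + z * (node d n).2 = (n == i.+1)%:R.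
  move=> nt; rewrite -phiE; last exact: node_in_hull.
  have /andP[n0 n13] := tn _ nt.
  have n13' : (n.-1 < 7 + 6)%N by rewrite prednK.
  rewrite -[n in LHS](prednK n0) -[n.-1]/(nat_of_ord (Ordinal n13')) nodal.
  rewrite -val_eqE /=; congr (_%:R); congr nat_of_bool.
  by rewrite eq_sym -(prednK n0) eqSS.
rewrite (affine_bary x y z p Dn0).
rewrite !val ?te ?inE ?eqxx ?orbT//=.
rewrite te in ut; move: ut.
rewrite /= !inE negb_or andbT => /andP[/andP[/negPf ab /negPf ac] /negPf bc].
case: (eqVneq a i.+1) => [ai|ai].
  by rewrite -ai eq_sym ab eq_sym ac !mul0r !addr0 mul1r.
case: (eqVneq b i.+1) => [bi|bi].
  by rewrite -bi [c == b]eq_sym bc !mul0r !addr0 add0r mul1r.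
case: (eqVneq c i.+1) => [ci|ci]; rewrite !mul0r !add0r ?mul1r //.
by rewrite ?addr0 bary3.
Qed.

Lemma phi_mesh_triangle i t p : t \in ccw_mesh -> mesh_triangle d t p ->
  phi i p = bary (node d (nth 0%N t 0)) (node d (nth 0%N t 1)) (node d (nth 0%N t 2))
      (index i.+1 t) p.
Proof. by move=> tm tp; have [a [b [c [-> //]]]] := phi_affine i tm. Qed.

Lemma grad_phi_mesh_triangle i t p : t \in ccw_mesh -> mesh_triangle d t p ->
  grad (phi i) p = (- (edge d t (index i.+1 t)).2 / triangle_det d t,
                    (edge d t (index i.+1 t)).1 / triangle_det d t).
Proof.
move=> tm tp; have [x [y [z [h1 h2]]]] := phi_affine i tm.
have [a [b [c [te ut tn]]]] := ccw_mesh_vertices tm.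
have Dn0 : triangle_det d t != 0 by rewrite gt_eqF// triangle_det_gt0.
have i3 : (index i.+1 t <= 3)%N by rewrite (leq_trans (index_size _ _))// te.
have [<- <-] := bary_grad i3 Dn0.
rewrite -!h2 /grad.
by rewrite !(@derive_affine _ _ x y z (mesh_triangle d t))//=; [congr (_, _); ring|exact: open_open_triangle..].
Qed.

(* At a point of an open triangle, [phi i] is positive exactly when node [i.+1] is a
   vertex, so the point determines the vertices. *)
Lemma mesh_triangle_disjoint t t' p : t \in ccw_mesh -> t' \in ccw_mesh ->
  mesh_triangle d t p -> mesh_triangle d t' p -> t = t'.
Proof.
move=> tm tm' tp tp'; apply: ccw_mesh_inj => // n nt.
have [a [b [c [te ut tn]]]] := ccw_mesh_vertices tm.
have [a' [b' [c' [te' _ _]]]] := ccw_mesh_vertices tm'.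
have /andP[n0 n13] := tn _ nt.
have n13' : (n.-1 < 7 + 6)%N by rewrite prednK.
have := phi_mesh_triangle (Ordinal n13') tm tp; rewrite (phi_mesh_triangle _ tm' tp')/= prednK// => h.
have : 0 < bary (node d (nth 0%N t 0)) (node d (nth 0%N t 1)) (node d (nth 0%N t 2))
      (index n t) p.
  by apply: bary_gt0 => //; [exact: (triangle_det_gt0 tm)|move: nt; rewrite -index_mem te].
rewrite -h => b0; rewrite -index_mem.
have : (index n t' <= 3)%N by rewrite (leq_trans (index_size _ _))// te'.
rewrite leq_eqVlt => /predU1P[e|]; last by rewrite {3}te'.
by move: b0; rewrite e bary3 ltxx.
Qed.

End hulls.

(** * The triangles cover the hexagon up to their edges *)

Section covering.
Context {R : realType}.
Notation s := (Num.sqrt 3 : R).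
Variable d : R.
Hypothesis hd : 1 + s <= d.

Lemma node_hull_trans l L : (forall n, n \in l -> node_hull d L (node d n)) ->
  node_hull d l `<=` node_hull d L.
Proof.
move=> lL p [w [w0 w1 ->]].
have /choice[u uP] : forall n, exists u : nat -> R, n \in l ->
    [/\ forall m, 0 <= u m, \sum_(m <- L) u m = 1
       & node d n = \sum_(m <- L) u m *: node d m].
  move=> n; case: (boolP (n \in l)) => [/lL[u hu]|_]; first by exists u.
  by exists (fun=> 0).
exists (fun m => \sum_(n <- l) w n * u n m); split=> [m||].
- rewrite big_seq; apply: sumr_ge0 => n nl; rewrite mulr_ge0//.
  by have [] := uP n nl.
- rewrite exchange_big/= -[RHS]w1 big_seq [RHS]big_seq; apply: eq_bigr => n nl.
  by rewrite -mulr_sumr; have [_ -> _] := uP n nl; rewrite mulr1.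
- under [RHS]eq_bigr do rewrite scaler_suml.
  rewrite exchange_big/= big_seq [RHS]big_seq; apply: eq_bigr => n nl.
  have [_ _ {1}->] := uP n nl; rewrite scaler_sumr.
  by apply: eq_bigr => m _; rewrite scalerA.
Qed.

Lemma node_in_hexagon n : (0 < n <= 13)%N -> node_hull d (iota 8 6) (node d n).
Proof.
have s1 := @sqrt3_gt R; have hd1 := hd; have h3 := @sqrt3_sqr R.
have outer m : m \in iota 8 6 -> node_hull d (iota 8 6) (node d m).
  by move=> mo; apply: node_in_hull.
have origin : node_hull d (iota 8 6) (node d 1).
  (* The origin is the midpoint of the opposite corners 8 and 11. *)
  apply: (@node_hull_trans [:: 8; 11]%N).
    by move=> m; rewrite !inE => /orP[] /eqP ->; apply: outer.
  exists (fun=> 1 / 2); split=> [_||].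
  - by lra.
  - by rewrite !big_cons big_nil; lra.
  - rewrite !big_cons big_nil !nodeE// /node_coord/= addr0.
    by rewrite [RHS]surjective_pairing/= /GRing.scale/=; congr (_, _); lra.
have inner k : (k < 6)%N -> node_hull d (iota 8 6) (node d (inner_node k)).
  move=> k6; apply: (@node_hull_trans [:: 1%N; outer_node k; outer_node k.+1]).
    move=> m; rewrite !inE => /or3P[] /eqP -> //.
      by case: k k6 => [|[|[|[|[|[|]]]]]] // _; apply: outer.
    by case: k k6 => [|[|[|[|[|[|]]]]]] // _; apply: outer.
  have ds : 2 < d * s by nra.
  have dsi : (d * s)^-1 * (d * s) = 1 by rewrite mulVf//; lra.
  have dsi0 : 0 < (d * s)^-1 by rewrite invr_gt0; lra.
  (* Two consecutive outer nodes add up to [d * s] times the inner node between them; the rest of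
     the weight goes to the origin and is nonnegative because [2 < d * s]. *)
  exists (fun m => if m == 1%N then 1 - 2 * (d * s)^-1 else (d * s)^-1).
  split=> [m||].
  - by case: ifP => _; nra.
  - rewrite !big_cons big_nil.
    by case: k k6 => [|[|[|[|[|[|]]]]]] // _; rewrite /=; lra.
  - have e3 : (d * s)^-1 * d * 3 = s.
      have := congr1 (fun x => (d * s)^-1 * d * x) h3.
      have := congr1 (fun x => x * s) dsi; move: ((d * s)^-1) => i /=; lra.
    rewrite !big_cons big_nil addr0.
    case: k k6 => [|[|[|[|[|[|]]]]]] // _; rewrite !nodeE// /node_coord;
    by rewrite [RHS]surjective_pairing/= /GRing.scale/=; congr (_, _); lra.
move=> /andP[n0 n13]; have [n8|n8] := leqP 8 n.
  by apply: outer; rewrite mem_iota n8.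
case: n n0 n13 n8 => [|[|n]] // _ _ n8.
rewrite (_ : n.+2 = inner_node n); last by rewrite /inner_node modn_small.
by apply: inner.
Qed.

Lemma mesh_triangle_Omega t : t \in ccw_mesh -> mesh_triangle d t `<=` Omega d.
Proof.
move=> tm; have [a [b [c [te ut tn]]]] := ccw_mesh_vertices tm.
rewrite -[X in X `<=` _](_ : interior (mesh_triangle d t) = _); last first.
  by apply/interior_id; exact: open_open_triangle.
apply: interiorS => p tp; apply: (@node_hull_trans t).
  by move=> n nt; apply: node_in_hexagon; exact: tn.
exact: mesh_triangle_hull.
Qed.

Lemma Omega_halfplane k p : (k < 6)%N -> Omega d p ->
  0 <= cross (node d (outer_node k)) (node d (outer_node k.+1)) p.
Proof.
move=> k6 /interior_subset [w [w0 w1 pE]].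
have s1 := @sqrt3_gt R.
have hd1 := hd.
have ds : 0 <= d * d * s / 2 by rewrite !mulr_ge0//; lra.
move: w1; rewrite {}pE !big_cons !big_nil !addr0 => w1.
rewrite (nodeE d (n := 8))// (nodeE d (n := 9))// (nodeE d (n := 10))//.
rewrite (nodeE d (n := 11))// (nodeE d (n := 12))// (nodeE d (n := 13))//.
rewrite /node_coord/=.
have := (w0 8, w0 9, w0 10, w0 11, w0 12, w0 13)%N.
move: (w 8%N) (w 9%N) (w 10%N) (w 11%N) (w 12%N) (w 13%N) w1.
move=> a0 a1 a2 a3 a4 a5 e [[[[[g0 g1] g2] g3] g4] g5].
have -> : a0 = 1 - (a1 + a2 + a3 + a4 + a5) by lra.
(* In units of [d * d * s / 2], the corners starting from [outer_node k] have [cross] values 0, 0,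
   1, 2, 2, 1 with respect to this side; [x] is their weighted mean. *)
suff [x x0 ->] : exists2 x : R, 0 <= x &
  cross (node d (outer_node k)) (node d (outer_node k.+1))
    ((1 - (a1 + a2 + a3 + a4 + a5)) *: (d * s / 2, - (d / 2)) +
    (a1 *: (d * s / 2, d / 2) + (a2 *: (0, d) + (a3 *: (- (d * s / 2), d / 2) +
    (a4 *: (- (d * s / 2), - (d / 2)) + (a5 *: (0, - d))))))) = d * d * s / 2 * x.
  by rewrite mulr_ge0.
case: k k6 => [|[|[|[|[|[|]]]]]] // _; rewrite !nodeE// /node_coord/cross/= /GRing.scale/=.
- exists (a2 + 2 * a3 + 2 * a4 + a5); lra.
- exists (a3 + 2 * a4 + 2 * a5 + a0); [lra|]; have -> : a0 = 1 - (a1 + a2 + a3 + a4 + a5) by lra.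
  lra.
- exists (a4 + 2 * a5 + 2 * a0 + a1); [lra|]; have -> : a0 = 1 - (a1 + a2 + a3 + a4 + a5) by lra.
  lra.
- exists (a5 + 2 * a0 + 2 * a1 + a2); [lra|]; have -> : a0 = 1 - (a1 + a2 + a3 + a4 + a5) by lra.
  lra.
- exists (a0 + 2 * a1 + 2 * a2 + a3); [lra|]; have -> : a0 = 1 - (a1 + a2 + a3 + a4 + a5) by lra.
  lra.
- exists (a1 + 2 * a2 + 2 * a3 + a4); lra.
Qed.

End covering.

(** These are the four triangles that meet the sextant between the rays through inner nodes [k] and
    [k.+1]; each of the two outer ones is cut in half by a ray. *)
Lemma mem_ccw_mesh k : (k < 6)%N ->
  [/\ [:: 1%N; inner_node k; inner_node k.+1] \in ccw_mesh,
      [:: inner_node k.+1; inner_node k; outer_node k.+1] \in ccw_mesh,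
      [:: outer_node k; outer_node k.+1; inner_node k] \in ccw_mesh &
      [:: outer_node k.+1; outer_node k.+2; inner_node k.+1] \in ccw_mesh].
Proof. by case: k => [|[|[|[|[|[|]]]]]]. Qed.

Section decomposition.
Context {R : realType}.
Notation s := (Num.sqrt 3 : R).
Variable d : R.
Hypothesis hd : 1 + s <= d.

Definition edge_lines (t : seq nat) : set (R * R) :=
  let P := node d (nth 0%N t 0) in
  let Q := node d (nth 0%N t 1) in
  let S := node d (nth 0%N t 2) in
  [set p | cross p Q S = 0] `|` [set p | cross P p S = 0] `|` [set p | cross P Q p = 0].

Lemma cross_swap (P Q S : R * R) : cross P S Q = - cross P Q S.
Proof. by rewrite /cross; ring. Qed.

(* In the sextant between inner nodes [k] and [k.+1] all terms on the right are positive
   once [p] is beyond the corresponding middle edge; this yields the third inequality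
   defining the outer triangle. *)
Lemma cross_ray_outer k p : (k < 6)%N ->
  cross (node d (outer_node k)) p (node d (inner_node k)) =
    - cross p (node d (inner_node k)) (node d (outer_node k.+1))
    + (d * s - 2) * cross (node d 1) (node d (inner_node k)) p /\
  cross p (node d (outer_node k.+2)) (node d (inner_node k.+1)) =
    - cross (node d (inner_node k.+1)) p (node d (outer_node k.+1))
    - (d * s - 2) * cross (node d 1) (node d (inner_node k.+1)) p.
Proof.
have h3 := @sqrt3_sqr R.
have e0 := congr1 (fun x => d * x) h3.
have e1 := congr1 (fun x => d * p.1 * x) h3.
have e2 := congr1 (fun x => d * p.2 * x) h3.
rewrite /= in e0 e1 e2.
case: k => [|[|[|[|[|[|]]]]]] // _; rewrite !nodeE// /node_coord /cross/=; split; lra.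
Qed.

(** Moving outwards, [p] is first compared with the inner-ring edge and then with the two other
    sides of the middle triangle; being past one of these puts it in the outer triangle on that
    side. Avoiding all edge lines makes every inequality strict. *)
Lemma sextant_cover k p : (k < 6)%N -> Omega d p ->
  0 < cross (node d 1) (node d (inner_node k)) p ->
  cross (node d 1) (node d (inner_node k.+1)) p < 0 ->
  (forall t, t \in ccw_mesh -> ~ edge_lines t p) ->
  exists2 t, t \in ccw_mesh & mesh_triangle d t p.
Proof.
move=> k6 Op fk fk1 noedge.
have s1 := @sqrt3_gt R; have hd1 := hd.
have ds : 2 < d * s by nra.
have [T1 T2 T3 T3'] := mem_ccw_mesh k6.
have [I1 I2] := cross_ray_outer p k6.
move: fk fk1 I1 I2.
have H := Omega_halfplane hd k6 Op.
have H' : 0 <= cross (node d (outer_node k.+1)) (node d (outer_node k.+2)) p.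
  have := @Omega_halfplane _ _ hd (k.+1 %% 6) p (ltn_pmod _ (isT : 0 < 6)%N) Op.
  have eo (m : nat) : outer_node (m %% 6) = outer_node m by rewrite /outer_node modn_mod.
  have eo1 (m : nat) : outer_node (m %% 6).+1 = outer_node m.+1.
    by rewrite /outer_node -[(m %% 6).+1]addn1 modnDml addn1.
  by rewrite eo eo1.
have := noedge _ T1; have := noedge _ T2; have := noedge _ T3; have := noedge _ T3'.
rewrite /edge_lines/=.
move=> /not_orP[/not_orP[/eqP n1 /eqP n2] /eqP n3].
move=> /not_orP[/not_orP[/eqP n4 /eqP n5] /eqP n6].
move=> /not_orP[/not_orP[/eqP n7 /eqP n8] /eqP n9].
move=> /not_orP[/not_orP[/eqP n10 /eqP n11] /eqP n12].
move: n1 n2 n3 n4 n5 n6 n7 n8 n9 n10 n11 n12.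
set O := node d 1; set v := node d (inner_node k).
set w := node d (inner_node k.+1).
set o' := node d (outer_node k). set o := node d (outer_node k.+1).
set o'' := node d (outer_node k.+2).
move=> n1 n2 n3 n4 n5 n6 n7 n8 n9 n10 n11 n12 fk fk1 I1 I2.
have Hpos : 0 < cross o' o p by rewrite lt_def n6.
have Hpos' : 0 < cross o o'' p by rewrite lt_def n3.
have [c1|c1] := ltP 0 (cross p v w).
  exists [:: 1%N; inner_node k; inner_node k.+1] => //.
  by split; rewrite //= cross_swap oppr_gt0.
have {}c1 : cross p v w < 0 by rewrite lt_def eq_sym n10.
have c1' : 0 < cross w v p by move: c1; rewrite /cross; lra.
have [c2|c2] := ltP 0 (cross p v o); last first.
  have {}c2 : cross p v o < 0 by rewrite lt_def eq_sym n7.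
  exists [:: outer_node k; outer_node k.+1; inner_node k] => //.
  split=> //=; first by rewrite cross_swap oppr_gt0.
  by rewrite -/v -/o' I1; nra.
have [c3|c3] := ltP 0 (cross w p o).
  by exists [:: inner_node k.+1; inner_node k; outer_node k.+1].
have {}c3 : cross w p o < 0 by rewrite lt_def eq_sym n8.
exists [:: outer_node k.+1; outer_node k.+2; inner_node k.+1] => //.
split=> //=; first by rewrite -/w -/o'' I2; nra.
by move: c3; rewrite -/w -/o /cross; lra.
Qed.

(** Opposite inner nodes give opposite signs of [f], so the signs of [f 0], [f 1], [f 2] determine
    all six. Going round the ring there is a drop from positive to negative, and it locates a
    sextant containing [p]. *)
Lemma mesh_triangle_cover p : Omega d p ->
  (exists2 t, t \in ccw_mesh & mesh_triangle d t p) \/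
  (exists2 t, t \in ccw_mesh & edge_lines t p).
Proof.
move=> Op; have [|noedge] := pselect (exists2 t, t \in ccw_mesh & edge_lines t p).
  by right.
left; have {}noedge t : t \in ccw_mesh -> ~ edge_lines t p.
  by move=> tm tp; apply: noedge; exists t.
pose f k := cross (node d 1) (node d (inner_node k)) p.
have f0 k : (k < 6)%N -> f k != 0.
  move=> k6; have [T1 _ _ _] := mem_ccw_mesh k6.
  by apply/eqP => fk; apply: (noedge _ T1); right.
have opp k : (k < 3)%N -> f (3 + k)%N = - f k.
  by case: k => [|[|[|]]] // _; rewrite /f !nodeE// /node_coord /cross/=; ring.
have sext k : (k < 6)%N -> 0 < f k -> f k.+1 < 0 -> exists2 t, t \in ccw_mesh & mesh_triangle d t p.
  by move=> k6 h1 h2; exact: (@sextant_cover k).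
have f6 : f 6%N = f 0%N by [].
have o0 := opp 0%N isT; have o1 := opp 1%N isT; have o2 := opp 2%N isT.
rewrite /= in o0 o1 o2.
have := f0 0%N isT; have := f0 1%N isT; have := f0 2%N isT.
rewrite !neq_lt => /orP[] h2 /orP[] h1 /orP[] h0.
- by apply: (sext 5%N) => //; lra.
- by apply: (sext 0%N) => //; lra.
- by apply: (sext 3%N) => //; lra.
- by apply: (sext 1%N) => //; lra.
- by apply: (sext 4%N) => //; lra.
- by apply: (sext 0%N) => //; lra.
- by apply: (sext 3%N) => //; lra.
- by apply: (sext 2%N) => //; lra.
Qed.

End decomposition.

(** * Assembly of the matrices *)

Section integration.
Context {R : realType}.
Notation s := (Num.sqrt 3 : R).
Notation mR := (measurableTypeR R).
Variable d : R.
Hypothesis hd : 1 + s <= d.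

Lemma null_edge_lines t : t \in ccw_mesh ->
  measurable (edge_lines d t : set (mR * mR)) /\ area (edge_lines d t) = 0%E.
Proof.
move=> tm; have D0 := triangle_det_gt0 hd tm; move: D0; rewrite /triangle_det /edge_lines.
move: (node d _) (node d _) (node d _) => S Q P D0.
have l1 : [set p : R * R | cross p Q S = 0] =
    line (Q.1 * S.2 - Q.2 * S.1) (Q.2 - S.2) (S.1 - Q.1).
  by apply/seteqP; split=> p /=; rewrite /line/= /cross => h; lra.
have l2 : [set p : R * R | cross P p S = 0] =
    line (S.1 * P.2 - S.2 * P.1) (S.2 - P.2) (P.1 - S.1).
  by apply/seteqP; split=> p /=; rewrite /line/= /cross => h; lra.
have l3 : [set p : R * R | cross P Q p = 0] =
    line (P.1 * Q.2 - P.2 * Q.1) (P.2 - Q.2) (Q.1 - P.1).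
  by apply/seteqP; split=> p /=; rewrite /line/= /cross => h; lra.
rewrite /= l1 l2 l3.
have ne (A B C : R * R) : (0 < cross P Q S -> (B.2 - C.2 = 0) -> (C.1 - B.1 = 0) -> False) ->
    (B.2 - C.2 != 0) || (C.1 - B.1 != 0).
  move=> h; rewrite -negb_and; apply/negP => /andP[/eqP h1 /eqP h2]; exact: h.
have n1 : (Q.2 - S.2 != 0) || (S.1 - Q.1 != 0).
  by apply: (ne P) => + /subr0_eq h1 /subr0_eq h2; rewrite /cross h1 h2; lra.
have n2 : (S.2 - P.2 != 0) || (P.1 - S.1 != 0).
  by apply: (ne P) => + /subr0_eq h1 /subr0_eq h2; rewrite /cross h1 h2; lra.
have n3 : (P.2 - Q.2 != 0) || (Q.1 - P.1 != 0).
  by apply: (ne P) => + /subr0_eq h1 /subr0_eq h2; rewrite /cross h1 h2; lra.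
have m1 := @measurable_line R.
split; first by apply: measurableU => //; apply: measurableU.
rewrite /area !null_set_setU//; try exact: measurableU; exact: area_line.
Qed.

Lemma null_all_edge_lines :
  let N := \big[setU/set0]_(t <- ccw_mesh) (edge_lines d t : set (mR * mR)) in
  measurable N /\ area N = 0%E.
Proof.
suff h (l : seq (seq nat)) : {subset l <= ccw_mesh} ->
  let N := \big[setU/set0]_(t <- l) (edge_lines d t : set (mR * mR)) in
  measurable N /\ area N = 0%E by exact: h.
elim: l => [_|t l ih tl]; first by rewrite /= big_nil; split=> //; rewrite /area measure0.
rewrite /= big_cons; have [|m1 n1] := ih; first by move=> x xl; apply: tl; rewrite inE xl orbT.
have [m2 n2] := null_edge_lines (tl t (mem_head _ _)).
split; first exact: measurableU.
by rewrite /area null_set_setU//.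
Qed.

Variable phi : 'I_(7 + 6) -> R * R -> R.
Hypothesis hphi : nodal_basis d phi.

(** [g t] is a measurable stand-in for [f], which is controlled only inside the triangles. There the
    integrals add up by disjointness; what is left of [Omega] lies on the null edge lines. *)
Lemma integral_Omega (f : R * R -> R) (g : seq nat -> mR * mR -> R) (c : seq nat -> R) :
  (forall t, t \in ccw_mesh -> measurable_fun setT (g t)) ->
  (forall t p, t \in ccw_mesh -> mesh_triangle d t p -> f p = g t p) ->
  (forall t, t \in ccw_mesh -> (\int[@area R]_(p in mesh_triangle d t) (g t p)%:E = (c t)%:E)%E) ->
  \int[@area R]_(p in Omega d) f p = \sum_(t <- ccw_mesh) c t.
Proof.
move=> mg fg ig; rewrite /Rintegral.
have [mN N0] := null_all_edge_lines.
have mtri t : measurable (mesh_triangle d t : set (mR * mR)) by exact: measurable_open_triangle.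
rewrite (integral_sub_null (mu := (@lebesgue_measure R \x @lebesgue_measure R)%E)
  (E := \big[setU/set0]_(t <- ccw_mesh) mesh_triangle d t) _ mN N0).
- rewrite integral_bigsetU_EFin//.
  + rewrite -[RHS]/(fine (\sum_(t <- ccw_mesh) c t)%:E) -sumEFin; congr fine.
    rewrite big_seq [RHS]big_seq; apply: eq_bigr => t tm; rewrite -ig//.
    by apply: eq_integral => p /set_mem tp; rewrite (fg t).
  + by apply/trivIsetP => t t' /= tm tm' /eqP tt'; apply/seteqP; split=> p //= [tp tp'];
      apply: tt'; apply: (mesh_triangle_disjoint hd hphi tm tm' tp tp').
  + suff h (l : seq (seq nat)) : {subset l <= ccw_mesh} ->
      measurable_fun (\big[setU/set0]_(t <- l) (mesh_triangle d t : set (mR * mR))) (EFin \o f).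
      exact: h.
    elim: l => [_|t l ih tl]; first by rewrite big_nil; exact: measurable_fun_set0.
    rewrite big_cons; apply/measurable_funU => //; first exact: bigsetU_measurable.
    split; last by apply: ih => x xl; apply: tl; rewrite inE xl orbT.
    apply: (eq_measurable_fun (EFin \o g t)).
      by move=> p /set_mem tp /=; rewrite (fg t)// tl// mem_head.
    by apply/measurable_EFinP; apply: measurable_funTS; apply: mg; rewrite tl// mem_head.
- rewrite -bigcup_seq => p [t /= tm tp]; exact: (mesh_triangle_Omega hd tm tp).
- move=> p [Op np]; rewrite -bigcup_seq; have [[t tm tp]|[t tm tp]] := mesh_triangle_cover hd Op.
    by exfalso; apply: np; rewrite -bigcup_seq; exists t.
  by exists t.
Qed.

Definition std_mass_table (i j : nat) : R :=
  if (i < 3)%N && (j < 3)%N then std_mass (i == j) else 0.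

(** The gradients are constant on each triangle: two factors [triangle_det] in the denominator
    against one from the area leave a single one. *)
Lemma stiffness_entry i j : stiffness d phi i j =
  \sum_(t <- ccw_mesh)
    std_area / triangle_det d t * dot (edge d t (index j.+1 t)) (edge d t (index i.+1 t)).
Proof.
rewrite mxE; pose c t : R := dot (edge d t (index j.+1 t)) (edge d t (index i.+1 t)) / triangle_det d t ^+ 2.
rewrite (@integral_Omega _ (fun t _ => c t)
  (fun t => std_area / triangle_det d t * dot (edge d t (index j.+1 t)) (edge d t (index i.+1 t))))//.
- move=> t p tm tp; rewrite !(grad_phi_mesh_triangle hd hphi _ tm tp) /dot/= /c /dot.
  have D0 : triangle_det d t != 0 by rewrite gt_eqF// triangle_det_gt0.
  by field.
- move=> t tm; rewrite integral_cst; last exact: measurable_open_triangle.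
  have D0 := triangle_det_gt0 hd tm.
  rewrite -[X in (_ * X)%E]/(area (mesh_triangle d t)) area_open_triangle//.
  rewrite -EFinM -/(triangle_det d t) /c; congr EFin.
  by field; rewrite gt_eqF.
Qed.

Lemma mass_entry i j : mass d phi i j =
  \sum_(t <- ccw_mesh) triangle_det d t * std_mass_table (index j.+1 t) (index i.+1 t).
Proof.
rewrite mxE.
pose b t k := bary (node d (nth 0%N t 0)) (node d (nth 0%N t 1)) (node d (nth 0%N t 2)) k.
rewrite (@integral_Omega _ (fun t p => b t (index j.+1 t) p * b t (index i.+1 t) p)
  (fun t => triangle_det d t * std_mass_table (index j.+1 t) (index i.+1 t)))//.
- by move=> t tm; apply: measurable_funM; exact: measurable_bary.
- by move=> t p tm tp; rewrite !(phi_mesh_triangle hd hphi _ tm tp).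
- move=> t tm; have D0 := triangle_det_gt0 hd tm.
  have [x [y [z [te _ _]]]] := ccw_mesh_vertices tm.
  have le3 n : (index n t <= 3)%N by rewrite (leq_trans (index_size _ _))// te.
  rewrite /std_mass_table; case: ifPn => [/andP[j3 i3]|].
    by rewrite integral_open_triangle_bary.
  have e0 n p : (3 <= index n t)%N -> b t (index n t) p = 0.
    move=> h; rewrite (_ : index n t = 3%N) ?/b ?bary3//.
    by apply/eqP; rewrite eqn_leq le3 h.
  rewrite negb_and -!leqNgt mulr0 => /orP[h|h]; apply: integral0_eq => p _.
    by rewrite e0// mul0r.
  by rewrite [X in _ * X]e0// mulr0.
Qed.

End integration.

Section assembly.
Context {R : realType}.

Definition assemble (l1 l2 l3 : nat -> nat -> R) (i j : nat) : R :=
  \sum_(k <- iota 0 6) (let t := [:: 1%N; inner_node k; inner_node k.+1] in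
      l1 (index i t) (index j t))
  + \sum_(k <- iota 0 6) (let t := [:: inner_node k.+1; inner_node k; outer_node k.+1] in
      l2 (index i t) (index j t))
  + \sum_(k <- iota 0 6) (let t := [:: outer_node k; outer_node k.+1; inner_node k] in
      l3 (index i t) (index j t)).

Definition sym_table (x y z w : R) : nat -> nat -> R :=
  gram_table [:: [:: x; y; z]; [:: y; x; z]; [:: z; z; w]].

(** The common shape of the first seven columns of A and M: [a], [b], [c], [e], [z] stand for the
    entries (1,1), (1,2), (2,2), (2,3), (8,2) in node numbers. *)
Definition stencil (a b c e z : R) : nat -> nat -> R :=
  gram_table [::
    [:: a; b; b; b; b; b; b];
    [:: b; c; e; 0; 0; 0; e];
    [:: b; e; c; e; 0; 0; 0];
    [:: b; 0; e; c; e; 0; 0];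
    [:: b; 0; 0; e; c; e; 0];
    [:: b; 0; 0; 0; e; c; e];
    [:: b; e; 0; 0; 0; e; c];
    [:: 0; z; 0; 0; 0; 0; z];
    [:: 0; z; z; 0; 0; 0; 0];
    [:: 0; 0; z; z; 0; 0; 0];
    [:: 0; 0; 0; z; z; 0; 0];
    [:: 0; 0; 0; 0; z; z; 0];
    [:: 0; 0; 0; 0; 0; z; z]].

(** The coefficients count triangles: six at the center; two along a spoke; two central, two middle
    and one outer at an inner-ring node; one central and one middle along a ring edge; one middle
    and one outer between the rings. *)
Lemma assemble_stencil (x1 y1 x2 y2 z2 w2 v3 q3 z3 x3 : R) i j :
  (i < 13)%N -> (j < 7)%N ->
  assemble (sym_table x1 y1 y1 x1) (sym_table x2 y2 z2 w2) (sym_table v3 q3 z3 x3)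
    i.+1 j.+1 =
  stencil (6 * x1) (2 * y1) (2 * x1 + 2 * x2 + x3) (y1 + y2) (z2 + z3) i j.
Proof.
move=> i13 j7; rewrite /assemble !big_cons !big_nil.
do 13?[case: i i13 => [|i] i13 //]; do 7?[case: j j7 => [|j] j7 //];
  rewrite /sym_table /stencil /gram_table /= ; lra.
Qed.

End assembly.

(** * Inner solutions *)

Section stencil_kernel.
Context {R : realType}.
Implicit Types (x y z a b c e : R) (u : nat -> R).

Definition stencil_row a b c e z u (i : nat) : R :=
  \sum_(0 <= j < 7) stencil a b c e z i j * u j.

Lemma stencil_rowE a b c e z u :
  [/\ stencil_row a b c e z u 0 = a * u 0%N + b * (u 1%N + u 2%N + u 3%N + u 4%N + u 5%N + u 6%N),
   [/\ stencil_row a b c e z u 1 = b * u 0%N + c * u 1%N + e * (u 6%N + u 2%N),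
   stencil_row a b c e z u 2 = b * u 0%N + c * u 2%N + e * (u 1%N + u 3%N),
   stencil_row a b c e z u 3 = b * u 0%N + c * u 3%N + e * (u 2%N + u 4%N),
   stencil_row a b c e z u 4 = b * u 0%N + c * u 4%N + e * (u 3%N + u 5%N) &
   stencil_row a b c e z u 5 = b * u 0%N + c * u 5%N + e * (u 4%N + u 6%N)],
   stencil_row a b c e z u 6 = b * u 0%N + c * u 6%N + e * (u 5%N + u 1%N),
   [/\ stencil_row a b c e z u 7 = z * (u 6%N + u 1%N),
   stencil_row a b c e z u 8 = z * (u 1%N + u 2%N),
   stencil_row a b c e z u 9 = z * (u 2%N + u 3%N) &
   stencil_row a b c e z u 10 = z * (u 3%N + u 4%N)] &
   stencil_row a b c e z u 11 = z * (u 4%N + u 5%N) /\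
   stencil_row a b c e z u 12 = z * (u 5%N + u 6%N)].
Proof.
rewrite /stencil_row /index_iota /= !big_cons !big_nil /stencil /gram_table /=.
by do !split; ring.
Qed.

Lemma triangle_form_eq0 (p q a b c : R) : 0 < p -> 0 < q ->
  p * ((a - b) ^+ 2 + (b - c) ^+ 2 + (c - a) ^+ 2) + q * (a + b + c) ^+ 2 <= 0 ->
  [/\ a = 0, b = 0 & c = 0].
Proof.
move=> p0 q0 h.
have g1 := sqr_ge0 (a - b); have g2 := sqr_ge0 (b - c); have g3 := sqr_ge0 (c - a).
have g4 := sqr_ge0 (a + b + c).
have h1 : (a - b) ^+ 2 = 0 by nra.
have h2 : (b - c) ^+ 2 = 0 by nra.
have h4 : (a + b + c) ^+ 2 = 0 by nra.
move: h1 h2 h4 => /eqP; rewrite sqrf_eq0 => /eqP h1 /eqP; rewrite sqrf_eq0 => /eqP h2.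
by move=> /eqP; rewrite sqrf_eq0 => /eqP h4; split; lra.
Qed.

(* Multiplying row [i] by [u i] and summing gives the energy of [u], which splits
   into a quadratic form on each triangle. *)
Lemma stencil_definite (x1 y1 x2 y2 x3 z : R) u :
  0 < x1 - y1 -> 0 < x1 + 2 * y1 -> 0 <= x2 + y2 -> 0 <= x2 - y2 -> 0 <= x3 ->
  (forall i, (i < 7)%N ->
    stencil_row (6 * x1) (2 * y1) (2 * x1 + 2 * x2 + x3) (y1 + y2) z u i = 0) ->
  forall i, (i < 7)%N -> u i = 0.
Proof.
move=> p0 q0 r0 t0 x30 row.
have [e0 [e1 e2 e3 e4 e5] e6 _ _] := stencil_rowE (6 * x1) (2 * y1)
  (2 * x1 + 2 * x2 + x3) (y1 + y2) z u.
move: e0 e1 e2 e3 e4 e5 e6; rewrite !row//.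
move uE0 : (u 0%N) => u0; move uE1 : (u 1%N) => u1; move uE2 : (u 2%N) => u2.
move uE3 : (u 3%N) => u3; move uE4 : (u 4%N) => u4; move uE5 : (u 5%N) => u5.
move uE6 : (u 6%N) => u6 e0 e1 e2 e3 e4 e5 e6.
(* [T / 3], [M / 2] and [x3 * v ^+ 2] are the local forms of central, middle and outer triangles;
   the coefficients in [T] and [M] are the eigenvalues of the local matrices. *)
pose T v w := (x1 - y1) * ((u0 - v) ^+ 2 + (v - w) ^+ 2 + (w - u0) ^+ 2)
  + (x1 + 2 * y1) * (u0 + v + w) ^+ 2.
pose M v w := (x2 + y2) * (v + w) ^+ 2 + (x2 - y2) * (v - w) ^+ 2.
have T0 v w : 0 <= T v w.
  rewrite /T; apply: addr_ge0; apply: mulr_ge0; rewrite ?sqr_ge0 ?(ltW p0) ?(ltW q0)//.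
  by rewrite !addr_ge0 ?sqr_ge0.
have M0 v w : 0 <= M v w.
  by rewrite /M; apply: addr_ge0; apply: mulr_ge0; rewrite ?sqr_ge0.
have N0 v : 0 <= x3 * v ^+ 2 by rewrite mulr_ge0 ?sqr_ge0.
have E : (T u1 u2 + T u2 u3 + T u3 u4 + T u4 u5 + T u5 u6 + T u6 u1) / 3
  + (M u1 u2 + M u2 u3 + M u3 u4 + M u4 u5 + M u5 u6 + M u6 u1) / 2
  + (x3 * u1 ^+ 2 + x3 * u2 ^+ 2 + x3 * u3 ^+ 2 + x3 * u4 ^+ 2 + x3 * u5 ^+ 2
    + x3 * u6 ^+ 2) = 0.
  have -> : 0 = u0 * 0 + u1 * 0 + u2 * 0 + u3 * 0 + u4 * 0 + u5 * 0 + u6 * 0 :> R by ring.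
  by rewrite {1}e0 {1}e1 {1}e2 {1}e3 {1}e4 {1}e5 {1}e6 /T /M; field.
have := (T0 u1 u2, T0 u2 u3, T0 u3 u4, T0 u4 u5, T0 u5 u6, T0 u6 u1).
have := (M0 u1 u2, M0 u2 u3, M0 u3 u4, M0 u4 u5, M0 u5 u6, M0 u6 u1).
have := (N0 u1, N0 u2, N0 u3, N0 u4, N0 u5, N0 u6).
move=> [[[[[? ?] ?] ?] ?] ?] [[[[[? ?] ?] ?] ?] ?] [[[[[? ?] ?] ?] ?] ?].
(* A zero sum of nonnegative terms has only zero terms, and three alternate central triangles
   already contain all seven nodes. *)
have [z0 z1 z2] : [/\ u0 = 0, u1 = 0 & u2 = 0].
  by apply: (triangle_form_eq0 p0 q0); rewrite -/(T u1 u2); lra.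
have [_ z3 z4] : [/\ u0 = 0, u3 = 0 & u4 = 0].
  by apply: (triangle_form_eq0 p0 q0); rewrite -/(T u3 u4); lra.
have [_ z5 z6] : [/\ u0 = 0, u5 = 0 & u6 = 0].
  by apply: (triangle_form_eq0 p0 q0); rewrite -/(T u5 u6); lra.
by case=> [|[|[|[|[|[|[|i]]]]]]] // _; rewrite ?uE0 ?uE1 ?uE2 ?uE3 ?uE4 ?uE5 ?uE6.
Qed.

Definition alt_sign : nat -> R := nth 0 [:: 0; 1; -1; 1; -1; 1; -1].

Lemma stencil_alternating a b c e z u : b != 0 -> z != 0 ->
  (forall i, (i < 13)%N -> stencil_row a b c e z u i = 0) ->
  (forall i, (i < 7)%N -> u i = u 1%N * alt_sign i) /\ (c - 2 * e) * u 1%N = 0.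
Proof.
move=> b0 z0 row.
have [_ [e1 e2 _ _ _] _ [e7 e8 e9 e10] [e11 e12]] := stencil_rowE a b c e z u.
rewrite !row// in e1 e2 e7 e8 e9 e10 e11 e12.
have zE v w : 0 = z * (v + w) -> w = - v.
  by move=> /esym/eqP; rewrite mulf_eq0 (negPf z0)/= addrC addr_eq0 => /eqP.
have u2 := zE _ _ e8; have u3 := zE _ _ e9; have u4 := zE _ _ e10.
have u5 := zE _ _ e11; have u6 := zE _ _ e12.
rewrite u2 opprK in u3; rewrite u3 in u4; rewrite u4 opprK in u5; rewrite u5 in u6.
rewrite u2 u3 u6 in e1 e2.
(* With alternating signs the two rows read [b * u 0 + (c - 2 * e) * u 1 = 0] and
   [b * u 0 - (c - 2 * e) * u 1 = 0]; add and subtract. *)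
have bu0 : b * u 0%N = 0 by lra.
have u00 : u 0%N = 0 by move/eqP: bu0; rewrite mulf_eq0 (negPf b0) => /eqP.
split; last by rewrite u00 in e1 e2; lra.
by case=> [|[|[|[|[|[|[|i]]]]]]] // _; rewrite ?u00 ?u6 ?u5 ?u4 ?u3 ?u2 /alt_sign/=; ring.
Qed.

Lemma alternating_row a b c e z i : (i < 13)%N -> c = 2 * e ->
  stencil_row a b c e z alt_sign i = 0.
Proof.
move=> i13 ->.
have [e0 [e1 e2 e3 e4 e5] e6 [e7 e8 e9 e10] [e11 e12]] :=
  stencil_rowE a b (2 * e) e z alt_sign.
by do 13?[case: i i13 => [|i] i13 //];
  rewrite ?e0 ?e1 ?e2 ?e3 ?e4 ?e5 ?e6 ?e7 ?e8 ?e9 ?e10 ?e11 ?e12 /alt_sign/=; ring.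
Qed.

End stencil_kernel.

Lemma inner_solutions_rowsP (R : realType) (A M : 'M[R]_(7 + 6)) lambda (u : 'cV[R]_7) :
  reflect (forall i, \sum_j (A i (lshift 6 j) - lambda * M i (lshift 6 j)) * u j 0 = 0)
    (u \in inner_solutions A M lambda).
Proof.
rewrite /inner_solutions memv_cap !memv_ker !lfunE /=.
apply: (iffP andP) => [[/eqP h1 /eqP h2] i|h1].
  have -> : i = unsplit (fintype.split i) by rewrite fintype.splitK.
  case: (fintype.split i) => k /=.
    have /matrixP/(_ k 0) := h1; rewrite !mxE => hk; rewrite -[RHS]hk.
    by apply: eq_bigr => j _; rewrite !mxE.
  have /matrixP/(_ k 0) := h2; rewrite !mxE => hk; rewrite -[RHS]hk.
  by apply: eq_bigr => j _; rewrite !mxE.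
split; apply/eqP/matrixP => i k; rewrite !mxE ord1.
  rewrite -[RHS](h1 (lshift 6 i)).
  by apply: eq_bigr => j _; rewrite !mxE.
rewrite -[RHS](h1 (rshift 7 i)).
by apply: eq_bigr => j _; rewrite !mxE.
Qed.

(** * Stencil coefficients of the mesh and the two ranges of [lambda] *)

Section solution.
Context {R : realType}.
Notation s := (Num.sqrt 3 : R).
Variable d : R.
Hypothesis hd : 1 + s <= d.
Variable phi : 'I_(7 + 6) -> R * R -> R.
Hypothesis hphi : nodal_basis d phi.

Lemma sum_ccw_mesh (F : seq nat -> nat -> nat -> R) (l1 l2 l3 : nat -> nat -> R) i j :
  (forall k a b, (k < 6)%N -> (a <= 3)%N -> (b <= 3)%N ->
    [/\ F [:: 1%N; inner_node k; inner_node k.+1] a b = l1 a b,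
        F [:: inner_node k.+1; inner_node k; outer_node k.+1] a b = l2 a b &
        F [:: outer_node k; outer_node k.+1; inner_node k] a b = l3 a b]) ->
  \sum_(t <- ccw_mesh) F t (index i t) (index j t) = assemble l1 l2 l3 i j.
Proof.
move=> Fl; rewrite /ccw_mesh !big_cat !big_map [LHS]addrA /assemble.
have le3 n (x y z : nat) : (index n [:: x; y; z] <= 3)%N by exact: index_size.
congr (_ + _ + _); rewrite big_seq [RHS]big_seq; apply: eq_bigr => k;
  rewrite mem_iota add0n => /= k6.
- by have [-> _ _] := Fl k _ _ k6 (le3 i 1%N (inner_node k) (inner_node k.+1))
    (le3 j 1%N (inner_node k) (inner_node k.+1)).
- by have [_ -> _] := Fl k _ _ k6 (le3 i (inner_node k.+1) (inner_node k) (outer_node k.+1))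
    (le3 j (inner_node k.+1) (inner_node k) (outer_node k.+1)).
- by have [_ _ ->] := Fl k _ _ k6 (le3 i (outer_node k) (outer_node k.+1) (inner_node k))
    (le3 j (outer_node k) (outer_node k.+1) (inner_node k)).
Qed.

Let h := d - s / 2.
Let H := d * s / 2 - 1.

Lemma h_gt0 : 0 < h.
Proof. by have s1 := @sqrt3_lt R; have s2 := @sqrt3_gt R; have hd1 := hd; rewrite /h; lra. Qed.

Lemma H_gt0 : 0 < H.
Proof. by have s1 := @sqrt3_gt R; have hd1 := hd; rewrite /H; nra. Qed.

Lemma d_gt0 : 0 < d.
Proof. by have s1 := @sqrt3_gt R; have hd1 := hd; lra. Qed.

(* Local stiffness coefficients, for the triangles at the center, in the middle and
   at the boundary: [x] and [y] on and off the diagonal (between inner nodes), [z]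
   between an inner and an outer node. *)
Let ax1 := std_area / (s / 2).
Let ay1 := - (std_area / (s / 2) / 2).
Let ax2 := std_area / h * (h * h + 1 / 4).
Let ay2 := std_area / h * (1 / 4 - h * h).
Let az2 := - (std_area / h / 2).
Let ax3 := std_area / (d * H) * (d * d).
Let az3 := - (std_area / (d * H) * (d * d / 2)).

Lemma stiffness_stencil i j (i' : 'I_(7 + 6)) (j' : 'I_(7 + 6)) :
  nat_of_ord i' = i -> nat_of_ord j' = j -> (j < 7)%N ->
  stiffness d phi i' j' = stencil (6 * ax1) (2 * ay1) (2 * ax1 + 2 * ax2 + ax3)
    (ay1 + ay2) (az2 + az3) i j.
Proof.
move=> ii jj j7; rewrite -ii -jj in j7 *; rewrite stiffness_entry//.
rewrite -(@assemble_stencil R ax1 ay1 ax2 ay2 az2 (std_area / h)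
  (std_area / (d * H) * (H * H + d * d / 4)) (std_area / (d * H) * (d * d / 4 - H * H)))//.
apply: (@sum_ccw_mesh (fun t b a => std_area / triangle_det d t * dot (edge d t a) (edge d t b))).
move=> k a b k6.
have [c1 c2] := mesh_center d k6; have [m1 m2] := mesh_middle d k6.
have [q1 q2] := mesh_outer d k6.
rewrite c1 c2 m1 m2 q1 q2 -/h -/H /sym_table /gram_center /gram_middle /gram_outer -/h -/H
  /gram_table => {c1 c2 m1 m2 q1 q2}.
rewrite /ax1 /ay1 /ax2 /ay2 /az2 /ax3 /az3.
by case: a => [|[|[|[|]]]] //; case: b => [|[|[|[|]]]] // _ _; split; rewrite /=; ring.
Qed.

Let mx1 := s / 2 * std_mass true.
Let my1 := s / 2 * std_mass false.
Let mx2 := h * std_mass true.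
Let my2 := h * std_mass false.
Let mx3 := d * H * std_mass true.
Let my3 := d * H * std_mass false.

Lemma mass_stencil i j (i' : 'I_(7 + 6)) (j' : 'I_(7 + 6)) :
  nat_of_ord i' = i -> nat_of_ord j' = j -> (j < 7)%N ->
  mass d phi i' j' = stencil (6 * mx1) (2 * my1) (2 * mx1 + 2 * mx2 + mx3)
    (my1 + my2) (my2 + my3) i j.
Proof.
move=> ii jj j7; rewrite -ii -jj in j7 *; rewrite mass_entry//.
rewrite -(@assemble_stencil R mx1 my1 mx2 my2 my2 mx2 mx3 my3)//.
apply: (@sum_ccw_mesh (fun t b a => triangle_det d t * std_mass_table a b)).
move=> k a b k6.
have [-> _] := mesh_center d k6; have [-> _] := mesh_middle d k6.
have [-> _] := mesh_outer d k6.
rewrite -/h -/H /sym_table /gram_table /std_mass_table /mx1 /mx2 /mx3 /my1 /my2 /my3.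
by case: a => [|[|[|[|]]]] //; case: b => [|[|[|[|]]]] // _ _; split; rewrite /= ?mulr0.
Qed.

Let A := stiffness d phi.
Let M := mass d phi.

Lemma inner_solutionsP lambda (u : 'cV[R]_7) :
  reflect (forall i, (i < 13)%N ->
    stencil_row (6 * (ax1 - lambda * mx1)) (2 * (ay1 - lambda * my1))
      (2 * (ax1 - lambda * mx1) + 2 * (ax2 - lambda * mx2) + (ax3 - lambda * mx3))
      ((ay1 - lambda * my1) + (ay2 - lambda * my2))
      ((az2 + az3) - lambda * (my2 + my3)) (fun j => u (inord j) 0) i = 0)
    (u \in inner_solutions A M lambda).
Proof.
have rowE (i : 'I_(7 + 6)) (i1 : nat) : nat_of_ord i = i1 ->
    \sum_j (A i (lshift 6 j) - lambda * M i (lshift 6 j)) * u j 0 =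
    stencil_row (6 * (ax1 - lambda * mx1)) (2 * (ay1 - lambda * my1))
      (2 * (ax1 - lambda * mx1) + 2 * (ax2 - lambda * mx2) + (ax3 - lambda * mx3))
      ((ay1 - lambda * my1) + (ay2 - lambda * my2))
      ((az2 + az3) - lambda * (my2 + my3)) (fun j => u (inord j) 0) i1.
  move=> ii; rewrite /stencil_row big_mkord; apply: eq_bigr => j _.
  rewrite inord_val /A /M (@stiffness_stencil i1 j i (lshift 6 j))// (@mass_stencil i1 j i (lshift 6 j))//.
  congr (_ * _); rewrite -ii; move: (ltn_ord i) (ltn_ord j).
  case: i {ii} => i /= _; case: j => j /= _ i13 j7.
  rewrite /stencil /gram_table.
  do 13?[case: i i13 => [|i] i13 //]; do 7?[case: j j7 => [|j] j7 //];
    rewrite /=; ring.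
apply: (iffP (inner_solutions_rowsP A M lambda u)) => [h1 i i13|h1 i].
  by rewrite -(rowE (Ordinal i13)).
by rewrite (rowE i _ erefl) h1.
Qed.

Let alt_stiffness := 2 * ax1 + 2 * ax2 + ax3 - 2 * (ay1 + ay2).
Let alt_mass := 2 * mx1 + 2 * mx2 + mx3 - 2 * (my1 + my2).

(** Each off-diagonal mass is paired with a larger diagonal one from the same triangle type; the
    outer triangle adds a positive term. *)
Lemma alt_mass_gt0 : 0 < alt_mass.
Proof.
have h0 := h_gt0; have s0 : 0 < s / 2 by have s1 := @sqrt3_gt R; lra.
have dH0 : 0 < d * H by rewrite mulr_gt0 ?d_gt0 ?H_gt0.
have k1 := @std_mass_lt R; have k0 := @std_mass_off_gt0 R.
have e1 : 0 < s / 2 * (std_mass true - std_mass false) by rewrite mulr_gt0// subr_gt0.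
have e2 : 0 < h * (std_mass true - std_mass false) by rewrite mulr_gt0// subr_gt0.
have e3 : 0 < d * H * std_mass true by rewrite mulr_gt0// (lt_trans k0).
rewrite /alt_mass /mx1 /mx2 /mx3 /my1 /my2; lra.
Qed.

Lemma idx_val n : (0 < n <= 13)%N -> nat_of_ord (idx n) = n.-1.
Proof. by case: n => // n /= n13; rewrite /idx inordK. Qed.

Lemma lambda_starE : lambda_star A M = alt_stiffness / alt_mass.
Proof.
rewrite /lambda_star /A /M.
rewrite !(@stiffness_stencil 1 1 (idx 2) (idx 2))// ?idx_val//.
rewrite !(@stiffness_stencil 1 2 (idx 2) (idx 3))// ?idx_val//.
rewrite !(@mass_stencil 1 1 (idx 2) (idx 2))// ?idx_val//.
by rewrite !(@mass_stencil 1 2 (idx 2) (idx 3))// ?idx_val//.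
Qed.

Lemma alternatingE (u : 'cV[R]_7) (w : R) :
  (forall i, (i < 7)%N -> u (inord i) 0 = w * alt_sign i) ->
  u = w *: alternating_vec R.
Proof.
move=> uE; apply/matrixP => i k; rewrite !ord1 !mxE -(uE i)// inord_val//.
Qed.

Lemma inner_solutions_alternating lambda (u : 'cV[R]_7) : u \in inner_solutions A M lambda ->
  exists2 w, u = w *: alternating_vec R & (alt_stiffness - lambda * alt_mass) * w = 0.
Proof.
move=> /inner_solutionsP row.
have h0 := h_gt0; have H0 := H_gt0; have d0 := d_gt0.
have s0 : 0 < s / 2 by have s1 := @sqrt3_gt R; lra.
have dH0 : 0 < d * H by rewrite mulr_gt0.
have k1 := @std_mass_lt R; have k0 := @std_mass_off_gt0 R; have ka := @std_area_gt0 R.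
have kt0 : 0 < std_mass true :> R by apply: lt_trans k1.
have q1 : 0 < ax1 by rewrite divr_gt0.
have ey1 : ay1 = - (ax1 / 2) by [].
have q2 : 0 < std_area / h by rewrite divr_gt0.
have q3 : 0 < std_area / (d * H) by rewrite divr_gt0.
have q4 : 0 < ax3 by apply: mulr_gt0 => //; exact: mulr_gt0.
have q5 : az3 = - (ax3 / 2) by rewrite /az3 /ax3; lra.
have q6 : ax2 + ay2 = std_area / h / 2 by rewrite /ax2 /ay2; lra.
have q7 : 0 < ax2 - ay2.
  have -> : ax2 - ay2 = std_area / h * (2 * (h * h)) by rewrite /ax2 /ay2; lra.
  by apply: mulr_gt0 => //; rewrite !mulr_gt0.
have m1 : 0 < mx1 - my1 by rewrite -mulrBr mulr_gt0// subr_gt0.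
have m2 : 0 < mx2 - my2 by rewrite -mulrBr mulr_gt0// subr_gt0.
have m3 : 0 < my1 by rewrite mulr_gt0.
have m4 : 0 < my2 by rewrite mulr_gt0.
have m5 : 0 < my3 by rewrite mulr_gt0.
have m6 : 0 < mx3 by rewrite mulr_gt0.
have [l0|l0] := ltP lambda 0.
  exists 0; last by rewrite mulr0.
  rewrite scale0r; apply/matrixP => i k; rewrite !ord1 mxE.
  have {}l0 : 0 < - lambda by rewrite oppr_gt0.
  have p1 : 0 < - lambda * (mx1 - my1) by rewrite mulr_gt0.
  have p2 : 0 < - lambda * (mx2 - my2) by rewrite mulr_gt0.
  have p3 : 0 < - lambda * my1 by rewrite mulr_gt0.
  have p4 : 0 < - lambda * my2 by rewrite mulr_gt0.
  have p6 : 0 < - lambda * mx3 by rewrite mulr_gt0.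
  rewrite -[i in LHS]inord_val.
  have definite := @stencil_definite R (ax1 - lambda * mx1) (ay1 - lambda * my1)
    (ax2 - lambda * mx2) (ay2 - lambda * my2) (ax3 - lambda * mx3)
    (az2 + az3 - lambda * (my2 + my3)) (fun j => u (inord j) 0).
  (* Constants have no energy, so [ax1 + 2 * ay1 = 0]; strict positivity of [x1 + 2 * y1] comes from
     the mass term alone and needs [lambda < 0]. *)
  apply: definite; [lra..| |exact: ltn_ord].
  by move=> j j7; apply: row; exact: ltn_trans j7 _.
have p3 : 0 <= lambda * my1 by rewrite mulr_ge0// ltW.
have p4 : 0 <= lambda * my2 by rewrite mulr_ge0// ltW.
have p5 : 0 <= lambda * my3 by rewrite mulr_ge0// ltW.
have b0 : 2 * (ay1 - lambda * my1) != 0 by rewrite lt_eqF//; lra.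
have z0 : az2 + az3 - lambda * (my2 + my3) != 0.
  by rewrite lt_eqF// /az2; lra.
have [uE c0] := stencil_alternating b0 z0 row.
exists (u (inord 1) 0); first exact: alternatingE.
by rewrite -[RHS]c0 /alt_stiffness /alt_mass; congr (_ * _); ring.
Qed.

Lemma alternating_in_inner_solutions lambda :
  alt_stiffness - lambda * alt_mass = 0 ->
  alternating_vec R \in inner_solutions A M lambda.
Proof.
move=> c0; apply/inner_solutionsP => i i13.
transitivity (stencil_row (6 * (ax1 - lambda * mx1)) (2 * (ay1 - lambda * my1))
      (2 * (ax1 - lambda * mx1) + 2 * (ax2 - lambda * mx2) + (ax3 - lambda * mx3))
      ((ay1 - lambda * my1) + (ay2 - lambda * my2))
      ((az2 + az3) - lambda * (my2 + my3)) alt_sign i).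
  rewrite /stencil_row big_nat [RHS]big_nat; apply: eq_bigr => j /andP[_ j7].
  by rewrite mxE inordK.
by apply: alternating_row => //; move: c0; rewrite /alt_stiffness /alt_mass; lra.
Qed.

Lemma inner_solutions_dichotomy lambda :
  (lambda = lambda_star A M ->
     inner_solutions A M lambda = <[alternating_vec R]>%VS)
  /\ (lambda <> lambda_star A M -> inner_solutions A M lambda = 0%VS).
Proof.
have m0 : alt_mass != 0 by rewrite gt_eqF// alt_mass_gt0.
rewrite lambda_starE; split=> [->|ne]; apply/vspaceP => u; apply/idP/idP.
- by move=> /inner_solutions_alternating[w -> _]; rewrite memvZ// memv_line.
- move=> /vlineP[w ->]; apply: memvZ; apply: alternating_in_inner_solutions.
  by rewrite divfK// subrr.
- move=> /inner_solutions_alternating[w -> /eqP]; rewrite mulf_eq0 => /orP[|/eqP ->].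
    by rewrite subr_eq0 => /eqP e; exfalso; apply: ne; rewrite e mulfK.
  by rewrite scale0r mem0v.
- by rewrite memv0 => /eqP ->; rewrite mem0v.
Qed.

End solution.

Theorem theorem4p1 (R : realType) (d : R) (hd : 1 + Num.sqrt 3 <= d)
    (phi : 'I_(7 + 6) -> R * R -> R) (hphi : nodal_basis d phi) (lambda : R) :
  let A := stiffness d phi in
  let M := mass d phi in
  (lambda = lambda_star A M ->
     inner_solutions A M lambda = <[alternating_vec R]>%VS)
  /\ (lambda <> lambda_star A M -> inner_solutions A M lambda = 0%VS).
Proof. exact: inner_solutions_dichotomy. Qed.
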